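(* Let $d\ge2$ and $M\ge N\ge1$ be integers, and let $|\psi\rangle,|\phi\rangle\in\mathbb{C}^d$ be independent Haar-random pure states with overlap $c=|\langle\psi|\phi\rangle|^2$. Upon measuring $\{\Pi_J\}_J$ on $|\psi\rangle^{\otimes N}\otimes|\phi\rangle^{\otimes M}$, the estimator of $c$ minimizing the global (Bayesian) mean square error, namely the posterior mean $$c_{\rm op}^{\rm bay}(J)=\frac{\int_0^1dc\;c\,p(c)\,p(J|c)}{\int_0^1dc\;p(c)\,p(J|c)},$$ is given for every $J\in\{\frac{M-N}{2},\frac{M-N}{2}+1,\dots,\frac{M+N}{2}\}$ by $$c_{\rm op}^{\rm bay}(J)=\frac{d+J+J^2+\frac{M+N}{2}-\left(\frac{M+N}{2}\right)^2+MN}{(d+M)(d+N)} .$$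
   Context: $p(c)=(d-1)(1-c)^{d-2}$ is the density of the overlap of two independent Haar-random pure states. By Schur–Weyl duality $(\mathbb{C}^d)^{\otimes(N+M)}\cong\bigoplus_Y\mathcal{U}^{(Y)}(SU(d))\otimes\mathcal{U}^{(Y)}(S_{N+M})$; $\Pi_J$ is the orthogonal projector onto the block of the two-row Young diagram with rows $\left(\frac{M+N}{2}+J,\,\frac{M+N}{2}-J\right)$. $p(J|c)=\langle\Psi|\Pi_J|\Psi\rangle$ with $|\Psi\rangle=|\psi\rangle^{\otimes N}\otimes|\phi\rangle^{\otimes M}$ for any unit vectors with $|\langle\psi|\phi\rangle|^2=c$ (it depends only on $c$). *)

(* Defs.v *)
From HB Require Import structures.
From mathcomp Require Import all_boot all_order all_fingroup all_algebra.
From mathcomp Require Import complex.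
From mathcomp Require Import all_classical all_reals all_analysis.
Set Implicit Arguments.
Unset Strict Implicit.
Unset Printing Implicit Defensive.
Import Order.TTheory GRing.Theory Num.Theory.
Import numFieldNormedType.Exports.
Local Open Scope classical_set_scope.
Local Open Scope ring_scope.
Local Open Scope complex_scope.
Local Open Scope sesquilinear_scope.

(* Vectors are row vectors and operators are matrices acting on the right.
   (C^d)^{(x) n} is the space of row vectors indexed by the multi-indices
   a : {ffun 'I_n -> 'I_d}; the coordinate a is the one along
   e_{a 0} (x) ... (x) e_{a (n-1)}. *)
Definition tdim (n d : nat) : nat := #|{ffun 'I_n -> 'I_d}|.

(* Permutation of the tensor factors: the factor in position i is moved to
   position s i, so that perm_op s *m perm_op t = perm_op (s * t). *)
Definition perm_op (C : pzRingType) (n d : nat) (s : 'S_n) : 'M[C]_(tdim n d) :=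
  \matrix_(a, b)
    (enum_val a == [ffun i => (enum_val b : {ffun 'I_n -> 'I_d}) (s i)])%:R.

(* The cells of the Young diagram with rows lam are numbered 0, ..., n-1 in
   reading order: cell i is in row [reshape_index lam i] and in column
   [reshape_offset lam i]. *)
Definition row_stab (n : nat) (lam : seq nat) : {set 'S_n} :=
  [set s : 'S_n |
    [forall i : 'I_n, reshape_index lam (s i) == reshape_index lam i]].

Definition col_stab (n : nat) (lam : seq nat) : {set 'S_n} :=
  [set s : 'S_n |
    [forall i : 'I_n, reshape_offset lam (s i) == reshape_offset lam i]].

Definition young_symmetrizer (C : pzRingType) (n d : nat) (lam : seq nat) :
    'M[C]_(tdim n d) :=
  \sum_(p in row_stab n lam) \sum_(q in col_stab n lam)
    (-1) ^+ odd_perm q *: (perm_op C d p *m perm_op C d q).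

(* The block U^(lam)(SU(d)) (x) U^(lam)(S_n) of Schur-Weyl duality: the image of
   the Young symmetrizer is one copy of the irreducible representation
   U^(lam)(SU(d)), and its translates by S_n span the whole block. *)
Definition schur_weyl_block (C : fieldType) (n d : nat) (lam : seq nat) :
    'M[C]_(tdim n d) :=
  (\sum_(s : 'S_n) (young_symmetrizer C n d lam *m perm_op C d s))%MS.

Section OverlapEstimation.
Variables (R : realType) (d : nat).
Local Notation C := R[i].

Definition unit_state (psi : 'rV[C]_d) : Prop := dotmx psi psi = 1.

Definition overlap (psi phi : 'rV[C]_d) : R :=
  complex.Re (`|dotmx psi phi| ^+ 2).

(* psi^{(x) N} (x) phi^{(x) M} *)
Definition product_state (N M : nat) (psi phi : 'rV[C]_d) :
    'rV[C]_(tdim (N + M) d) :=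
  \row_a \prod_(i < N + M)
    (if (i < N)%N then psi else phi) 0
      ((enum_val a : {ffun 'I_(N + M) -> 'I_d}) i).

(* The possible values of J are (M - N)/2 + j for j = 0, ..., N; the rows
   (M + N)/2 + J and (M + N)/2 - J of the diagram are then M + j and N - j. *)
Definition spin (N M j : nat) : R := (M%:R - N%:R) / 2 + j%:R.

Definition Pi_J (N M j : nat) : 'M[C]_(tdim (N + M) d) :=
  proj_ortho (schur_weyl_block C (N + M) d [:: (M + j)%N; (N - j)%N]).

(* <Psi| Pi_J |Psi>, a real number since Pi_J is self-adjoint *)
Definition outcome_prob (N M j : nat) (psi phi : 'rV[C]_d) : R :=
  let Psi := product_state N M psi phi in
  complex.Re (dotmx (Psi *m Pi_J N M j) Psi).

(* p(J|c): the value of <Psi| Pi_J |Psi> at any pair of unit vectors with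
   overlap c, and 0 if there is no such pair *)
Definition cond_prob (N M j : nat) (c : R) : R :=
  xget 0 [set x | exists psi phi : 'rV[C]_d,
    [/\ unit_state psi, unit_state phi, overlap psi phi = c
      & outcome_prob N M j psi phi = x]].

Definition overlap_density (c : R) : R := (d%:R - 1) * (1 - c) ^+ (d - 2).

Definition posterior_mean (N M j : nat) : R :=
  (\int[lebesgue_measure]_(c in `[0, 1])
      (c * overlap_density c * cond_prob N M j c)) /
  (\int[lebesgue_measure]_(c in `[0, 1])
      (overlap_density c * cond_prob N M j c)).

(* Borel sets of C^d, generated by the real and imaginary parts of the
   coordinates *)
Definition state_cylinders : set_system 'rV[C]_d :=
  [set A | exists (i : 'I_d) (B : set R), measurable B /\
    (A = [set v : 'rV[C]_d | B (complex.Re (v 0 i))] \/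
     A = [set v : 'rV[C]_d | B (complex.Im (v 0 i))])].

Definition state_borel : set_system 'rV[C]_d := <<s state_cylinders >>.

Section RandomStates.
Variables (disp : measure_display) (T : measurableType disp).
Variable P : probability T R.

(* Random unit vector whose law is invariant under the unitary group *)
Definition haar_random_state (psi : T -> 'rV[C]_d) : Prop :=
  [/\ forall A, state_borel A -> measurable (psi @^-1` A),
      forall w, unit_state (psi w)
    & forall U : 'M[C]_d, U \is unitarymx -> forall A, state_borel A ->
        P [set w | A (psi w *m U)] = P (psi @^-1` A)].

Definition independent_states (psi phi : T -> 'rV[C]_d) : Prop :=
  forall A B, state_borel A -> state_borel B ->
    P (psi @^-1` A `&` phi @^-1` B) = (P (psi @^-1` A) * P (phi @^-1` B))%E.

(* Global mean square error of an estimator: average over the random states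
   and over the outcome J of the measurement. The blocks which are not listed
   here have probability 0. *)
Definition global_mse (N M : nat) (psi phi : T -> 'rV[C]_d)
    (est : 'I_N.+1 -> R) : \bar R :=
  'E_P[fun w => \sum_(j < N.+1) outcome_prob N M j (psi w) (phi w) *
                  (est j - overlap (psi w) (phi w)) ^+ 2].

Definition minimizes_mse (N M : nat) (psi phi : T -> 'rV[C]_d)
    (est : 'I_N.+1 -> R) : Prop :=
  forall est' : 'I_N.+1 -> R,
    (global_mse M psi phi est <= global_mse M psi phi est')%E.

End RandomStates.
End OverlapEstimation.

(* Main.v *)
From HB Require Import structures.
Require Import Defs.
From mathcomp Require Import all_boot all_order all_fingroup all_algebra.
From mathcomp Require Import complex zify ring.
From mathcomp Require Import all_classical all_reals all_analysis.
From mathcomp Require Import measurable_realfun.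
Set Implicit Arguments.
Unset Strict Implicit.
Unset Printing Implicit Defensive.
Import Order.TTheory GRing.Theory Num.Theory.
Import numFieldNormedType.Exports.

(** The projector Pi_J lies in the span of the permutation operators, so
    p(J|c) = sum_s x_s c^k(s), where k(s) is the number of factors that s moves
    from the first N positions to the last M. The sum of all transpositions is
    central and acts on the block of a Young diagram by a scalar kappa, while
    composing s with all transpositions shifts k(s) by at most
    one with explicit multiplicities. Against the density p(c), whose moments
    mu_k satisfy (k + 1) mu_k = (k + d) mu_(k + 1), all the dependence on k
    cancels and kappa E[p_J] = alpha E[p_J] + beta E[c p_J] remains, with
    alpha and beta depending on d, N and M only; this is the closed form.
    The denominator E[p_J] is positive because p(J|0) > 0: the Young
    symmetrizer has a nonzero diagonal entry at a basis vector with N letters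
    e_0 and M letters e_1.

    For independent Haar-random states unitary invariance alone forces the
    same moments: E|<psi|v>|^2k is proportional to |v|^2k, and comparing the
    coefficients of t^2 for v = e_0 + t e_i relates the moments of order k and
    k + 1. Hence the mean square error is a sum over J of quadratic
    polynomials in the estimates, minimal exactly at the posterior mean. *)

Local Open Scope complex_scope.
Local Open Scope ring_scope.
Local Open Scope sesquilinear_scope.

(** * The projectors lie in the span of the permutation operators *)

Section PermutationAlgebra.
Variables (C : numClosedFieldType) (n d : nat).
Implicit Types s t p q : 'S_n.
Local Notation P s := (@perm_op C n d s).

Definition shuffle (s : 'S_n) (f : {ffun 'I_n -> 'I_d}) : {ffun 'I_n -> 'I_d} :=
  [ffun i => f (s i)].

Lemma shuffleM s t f : shuffle s (shuffle t f) = shuffle (s * t)%g f.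
Proof. by apply/ffunP => i; rewrite !ffunE permM. Qed.

Lemma shuffle1 f : shuffle 1%g f = f.
Proof. by apply/ffunP => i; rewrite ffunE perm1. Qed.

Lemma perm_opE s a b : P s a b = (enum_val a == shuffle s (enum_val b))%:R.
Proof. by rewrite mxE. Qed.

Lemma mulmx_perm_op m (A : 'M[C]_(m, tdim n d)) s i b :
  (A *m P s) i b = A i (enum_rank (shuffle s (enum_val b))).
Proof.
rewrite mxE (bigD1 (enum_rank (shuffle s (enum_val b)))) //= big1 => [|a neq].
  by rewrite addr0 perm_opE enum_rankK eqxx mulr1.
rewrite perm_opE; case: eqP => [ea|_]; last by rewrite mulr0.
by move: neq; rewrite -ea enum_valK eqxx.
Qed.

Lemma perm_opM s t : P s *m P t = P (s * t)%g.
Proof.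
by apply/matrixP => a b; rewrite mulmx_perm_op !perm_opE enum_rankK shuffleM.
Qed.

Lemma perm_op1 : P 1%g = 1%:M.
Proof.
apply/matrixP => a b; rewrite perm_opE shuffle1 mxE.
by rewrite (inj_eq enum_val_inj).
Qed.

Lemma perm_opV s : (P s)^t* = P (s^-1)%g.
Proof.
apply/matrixP => a b; rewrite mxE mxE !perm_opE conjC_nat; congr (_%:R).
congr (nat_of_bool _); apply/eqP/eqP => ->.
  by rewrite shuffleM mulVg shuffle1.
by rewrite shuffleM mulgV shuffle1.
Qed.

Definition perm_alg (A : 'M[C]_(tdim n d)) : Prop :=
  exists x : 'S_n -> C, A = \sum_s x s *: P s.

Lemma perm_algZ c A : perm_alg A -> perm_alg (c *: A).
Proof.
case=> x ->; exists (fun s => c * x s); rewrite scaler_sumr.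
by apply: eq_bigr => s _; rewrite scalerA.
Qed.

Lemma perm_algD A B : perm_alg A -> perm_alg B -> perm_alg (A + B).
Proof.
case=> x -> [y ->]; exists (fun s => x s + y s); rewrite -big_split /=.
by apply: eq_bigr => s _; rewrite scalerDl.
Qed.

Lemma perm_alg_perm_op s : perm_alg (P s).
Proof.
exists (fun t => (t == s)%:R); rewrite (bigD1 s) //= eqxx scale1r big1 ?addr0 //.
by move=> t /negPf ->; rewrite scale0r.
Qed.

Lemma perm_alg0 : perm_alg 0.
Proof. by exists (fun=> 0); rewrite big1 // => s _; rewrite scale0r. Qed.

Lemma perm_alg_sum (I : Type) (r : seq I) (Q : pred I) F :
  (forall i, Q i -> perm_alg (F i)) -> perm_alg (\sum_(i <- r | Q i) F i).
Proof. by apply: big_ind; [exact: perm_alg0 | exact: perm_algD]. Qed.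

Lemma perm_algM A B : perm_alg A -> perm_alg B -> perm_alg (A *m B).
Proof.
case=> x -> [y ->]; rewrite mulmx_suml; apply: perm_alg_sum => s _.
rewrite mulmx_sumr; apply: perm_alg_sum => t _.
by rewrite -scalemxAl -scalemxAr perm_opM; do 2!apply: perm_algZ; exact: perm_alg_perm_op.
Qed.

Lemma perm_alg_adj A : perm_alg A -> perm_alg (A^t*).
Proof.
case=> x ->; rewrite !raddf_sum /=; apply: perm_alg_sum => s _.
rewrite linearZ /= map_mxZ -/(_ ^t*) perm_opV.
by apply: perm_algZ; exact: perm_alg_perm_op.
Qed.

Lemma perm_alg1 : perm_alg 1%:M.
Proof. by rewrite -perm_op1; exact: perm_alg_perm_op. Qed.

End PermutationAlgebra.

(** * Orthogonal projectors as polynomials in a Gram operator *)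

Section OrthogonalProjector.
Variables (C : numClosedFieldType) (m : nat).

(** A diagonal entry of the sum is the sum of the squared moduli of all entries in one column of the
    [A i]. *)
Lemma sum_adj_mul_eq0 (I : finType) (p : nat) (A : I -> 'M[C]_(p, m)) :
  \sum_i (A i)^t* *m A i = 0 -> forall i, A i = 0.
Proof.
move=> /matrixP A0 i; apply/matrixP => a b; rewrite mxE.
have := A0 b b; rewrite mxE summxE.
have ge0 k x : 0 <= (A k)^t* b x * A k x b.
  by rewrite !mxE mulrC mul_conjC_ge0.
under eq_bigr do rewrite mxE.
move=> /psumr_eq0P -/(_ (fun k _ => sumr_ge0 _ (fun x _ => ge0 k x))) /(_ i isT).
move=> /psumr_eq0P -/(_ (fun x _ => ge0 i x)) /(_ a isT).
by rewrite !mxE mulrC => /eqP; rewrite mul_conjC_eq0 => /eqP.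
Qed.

Definition shift_prod (h : 'M[C]_m) (r : seq C) : 'M[C]_m :=
  foldr (fun c A => (1%:M - c *: h) *m A) 1%:M r.

Lemma shift_prod_eigen (h : 'M[C]_m) r (v : 'rV[C]_m) l : v *m h = l *: v ->
  v *m shift_prod h r = (\prod_(c <- r) (1 - c * l)) *: v.
Proof.
move=> vh; elim: r => [|c r IH] /=; first by rewrite mulmx1 big_nil scale1r.
rewrite mulmxA mulmxBr mulmx1 -scalemxAr vh scalerA -{1}[v]scale1r -scalerBl.
by rewrite -scalemxAl IH scalerA big_cons.
Qed.

(** Every factor [1 - c h] is 1 up to a right multiple of [h], hence so is the product. Thus
    [1 - shift_prod h r] kills every row vector that [h] kills. *)
Lemma shift_prod_compl (h : 'M[C]_m) r :
  exists X, 1%:M - shift_prod h r = h *m X.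
Proof.
elim: r => [|c r [X IH]] /=; first by exists 0; rewrite subrr mulmx0.
exists (X + c *: shift_prod h r); rewrite mulmxBl mul1mx opprB addrCA.
by rewrite IH mulmxDr addrC -scalemxAl -scalemxAr.
Qed.

Lemma sub_proj_ortho_mul_adj p q r (U : 'M[C]_(p, m)) (A : 'M[C]_(q, m))
    (V : 'M[C]_(r, m)) :
  (A <= U)%MS -> (V - V *m proj_ortho U) *m A^t* = 0.
Proof.
move=> AU; apply/orthomx1P; apply: submx_trans (proj_ortho_compl_sub U V) _.
by rewrite orthomx_sym (submx_trans AU) // orthomx_sym.
Qed.

(* The orthogonal projector onto the span of the rows of the [A i] is
   [1 - \prod_l (1 - h / l)] where [l] runs over the nonzero eigenvalues of the
   Gram operator [h]; the factors at [l = 0] are [1] because [0^-1 = 0]. *)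
Lemma proj_ortho_sums_prod (I : finType) (A : I -> 'M[C]_m) :
  let h := \sum_i (A i)^t* *m A i in
  exists r, proj_ortho (\sum_i A i)%MS = 1%:M - shift_prod h r.
Proof.
move=> h; have hherm : h^t* = h.
  rewrite /h !raddf_sum /=; apply: eq_bigr => i _.
  by rewrite trmx_mul map_mxM -/((A i)^t*) trmxCK.
have hn : h \is normalmx by apply/normalmxP; rewrite hherm.
set Q := spectralmx h; set sp := spectral_diag h.
pose r := [seq (sp 0 i)^-1 | i <- enum 'I_m]; exists r.
have hE := orthomx_spectralP hn; rewrite -/Q -/sp in hE.
have Qh : Q *m h = diag_mx sp *m Q.
  by rewrite hE !mulmxA mulmxV ?spectral_unit // mul1mx.
set E := shift_prod h r.
(* Tested on the eigenvectors forming the rows of [Q]: the factor of a nonzero eigenvalue vanishes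
   on its row, and [h] itself kills the rows of eigenvalue 0. *)
have hE0 : h *m E = 0.
  apply: (@row_full_inj _ _ _ _ Q); first by rewrite row_full_unit spectral_unit.
  rewrite mulmx0 mulmxA; apply/row_matrixP => i.
  rewrite row_mul Qh row_mul row_diag_mx -scalemxAl -rowE -scalemxAl.
  have eig : row i Q *m h = sp 0 i *: row i Q.
    by rewrite -row_mul Qh row_mul row_diag_mx -scalemxAl -rowE.
  rewrite (shift_prod_eigen _ eig) scalerA row0 /r big_map big_enum /=.
  rewrite (bigD1 i) //=; have [->|nz] := eqVneq (sp 0 i) 0.
    by rewrite mul0r scale0r.
  by rewrite mulVf // subrr mul0r mulr0 scale0r.
(* The Gram operator of the products [A i *m E] is [E^* h E = 0]. *)
have AE i : A i *m E = 0.
  apply: (@sum_adj_mul_eq0 I m (fun i => A i *m E)) i.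
  transitivity (E^t* *m (h *m E)); last by rewrite hE0 mulmx0.
  rewrite /h mulmx_suml mulmx_sumr; apply: eq_bigr => i _.
  by rewrite trmx_mul map_mxM !mulmxA.
have [X EX] := shift_prod_compl h r; rewrite -/E in EX.
set W := (\sum_i A i)%MS; set pr := proj_ortho W.
have WE p (V : 'M[C]_(p, m)) : (V <= W)%MS -> V *m E = 0.
  move=> /sub_sumsmxP[B ->]; rewrite mulmx_suml big1 // => i _.
  by rewrite -mulmxA AE mulmx0.
(* [1 - E] is the identity on [W] and, by the next step, zero on the orthogonal complement, so it is
   [pr]. *)
have prE : pr *m (1%:M - E) = pr.
  rewrite mulmxBr mulmx1 WE ?subr0 //.
  by rewrite -[pr]mul1mx; exact: proj_ortho_sub.
have cprE : (1%:M - pr) *m (1%:M - E) = 0.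
  rewrite EX mulmxA; suff -> : (1%:M - pr) *m h = 0 by rewrite mul0mx.
  rewrite /h mulmx_sumr big1 // => i _; rewrite mulmxA -[pr]mul1mx.
  by rewrite sub_proj_ortho_mul_adj ?mul0mx // /W; apply: (sumsmx_sup i).
by rewrite -[RHS]mul1mx -[X in X *m _](subrK pr) mulmxDl cprE add0r prE.
Qed.

Lemma dot_proj_ortho p (U : 'M[C]_(p, m)) (v : 'rV[C]_m) :
  dotmx (v *m proj_ortho U) v = dotmx (v *m proj_ortho U) (v *m proj_ortho U).
Proof.
have cU := proj_ortho_compl_sub U v.
have : v *m proj_ortho U *m (v - v *m proj_ortho U)^t* = 0.
  apply/orthomx1P; apply: submx_trans (proj_ortho_sub _ _) _.
  by rewrite orthomx_sym.
by rewrite linearB /= map_mxB mulmxBr => /subr0_eq e; rewrite !dotmxE e.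
Qed.

End OrthogonalProjector.

(** * Young symmetrizers and projectors onto Schur-Weyl blocks *)

Section SchurWeylBlock.
Variables (C : numClosedFieldType) (n d : nat) (lam : seq nat).
Implicit Types s t p q : 'S_n.
Local Notation P s := (@perm_op C n d s).
Local Notation Y := (young_symmetrizer C n d lam).
Local Notation Pi := (proj_ortho (schur_weyl_block C n d lam)).

Lemma perm_alg_young_symmetrizer : perm_alg Y.
Proof.
apply: perm_alg_sum => p _; apply: perm_alg_sum => q _; apply: perm_algZ.
by rewrite perm_opM; exact: perm_alg_perm_op.
Qed.

Lemma perm_alg_proj_block : perm_alg Pi.
Proof.
have [r ->] := proj_ortho_sums_prod (fun s : 'S_n => Y *m P s).
set h := \sum_s _; have hA : perm_alg h.
  apply: perm_alg_sum => s _; apply: perm_algM; first apply: perm_alg_adj.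
    by apply: perm_algM; [exact: perm_alg_young_symmetrizer | exact: perm_alg_perm_op].
  by apply: perm_algM; [exact: perm_alg_young_symmetrizer | exact: perm_alg_perm_op].
have BA A B : @perm_alg C n d A -> perm_alg B -> perm_alg (A - B).
  by move=> HA HB; rewrite -scaleN1r; apply: perm_algD => //; exact: perm_algZ.
apply: (BA _ _); first exact: perm_alg1.
elim: r => [|c r IH] /=; first exact: perm_alg1.
apply: perm_algM => //; apply: (BA _ _); [exact: perm_alg1 | exact: perm_algZ].
Qed.

(** Every row of the block is a combination of rows of the [Y *m P s]; the central [Z] passes
    through [P s] and meets [Y]. *)
Lemma proj_block_central_eigen (Z : 'M[C]_(tdim n d)) k :
  (forall s, P s *m Z = Z *m P s) -> Y *m Z = k *: Y -> Pi *m Z = k *: Pi.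
Proof.
move=> cZ YZ; have := proj_ortho_sub (schur_weyl_block C n d lam) 1%:M.
rewrite mul1mx => /sub_sumsmxP[B ->]; rewrite mulmx_suml scaler_sumr.
apply: eq_bigr => s _; rewrite -!mulmxA cZ (mulmxA Y) YZ.
by rewrite -scalemxAl -scalemxAr.
Qed.

Lemma young_symmetrizer_mul :
  Y = (\sum_(p in row_stab n lam) P p) *m
      (\sum_(q in col_stab n lam) (-1) ^+ odd_perm q *: P q).
Proof.
rewrite mulmx_suml; apply: eq_bigr => p _; rewrite mulmx_sumr.
by apply: eq_bigr => q _; rewrite -scalemxAr.
Qed.

Lemma row_sum_perm_op t : t \in row_stab n lam ->
  (\sum_(p in row_stab n lam) P p) *m P t = \sum_(p in row_stab n lam) P p.
Proof.
rewrite inE => /forallP tR; rewrite mulmx_suml.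
rewrite [RHS](reindex_inj (mulIg t)) /=; apply: eq_big => [p|p _].
  by rewrite !inE; apply: eq_forallb => i; rewrite permM (eqP (tR _)).
by rewrite perm_opM.
Qed.

Lemma perm_op_col_sum t : t \in col_stab n lam ->
  P t *m (\sum_(q in col_stab n lam) (-1) ^+ odd_perm q *: P q) =
  (-1) ^+ odd_perm t *: \sum_(q in col_stab n lam) (-1) ^+ odd_perm q *: P q.
Proof.
rewrite inE => /forallP tR; rewrite mulmx_sumr.
rewrite [in RHS](reindex_inj (mulgI t)) /= scaler_sumr.
apply: eq_big => [p|p _].
  rewrite !inE; apply/forallP/forallP => H i.
    by rewrite permM (eqP (H _)).
  by have := H (t^-1 i)%g; rewrite permM -[in X in _ == X](eqP (tR _)) !permKV.
rewrite -scalemxAr perm_opM odd_permM signr_addb mulrC scalerA.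
by rewrite mulrCA -expr2 sqrr_sign mulr1.
Qed.

End SchurWeylBlock.

(** * Eigenvalue of the sum of transpositions on a two-row block *)

Lemma reshape_index_two_rows r1 r2 i : (i < r1 + r2)%N ->
  reshape_index [:: r1; r2] i = (r1 <= i)%N.
Proof.
move=> lti; rewrite /reshape_index /= subn_eq0.
by case: leqP => //= h; rewrite -subnDA subn_eq0 lti.
Qed.

Lemma reshape_offset_two_rows r1 r2 i : (i < r1 + r2)%N ->
  reshape_offset [:: r1; r2] i = if (r1 <= i)%N then (i - r1)%N else i.
Proof.
move=> lti; rewrite /reshape_offset reshape_index_two_rows //.
by case: ifP => _ /=; rewrite ?addn0 ?subn0.
Qed.

Definition two_row_weight (C : pzRingType) (r1 x y : nat) : C :=
  if (r1 <= x)%N == (r1 <= y)%N then 1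
  else if (if (r1 <= x)%N then (x - r1)%N else x) ==
          (if (r1 <= y)%N then (y - r1)%N else y) then -1 else 0.

(** There are [r1 ^ 2 + r2 ^ 2] ordered pairs in a common row, equal cells included, and each of the
    [r2] columns of length two gives two ordered pairs of weight -1. *)
Lemma sum_two_row_weight (C : comPzRingType) n r1 r2 :
  (r2 <= r1)%N -> n = (r1 + r2)%N ->
  \sum_(x < n) \sum_(y < n) two_row_weight C r1 x y =
  (r1 ^ 2 + r2 ^ 2)%N%:R - r2%:R *+ 2.
Proof.
move=> hr ->; rewrite /two_row_weight.
have S (u : 'I_r2) : \sum_(x < r1) (if (x : nat) == u then -1 else 0) = -1 :> C.
  by rewrite -big_mkcond /= (big_pred1 (widen_ord hr u)).
have ltF (x : 'I_r1) : (r1 <= x)%N = false by rewrite leqNgt ltn_ord.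
rewrite big_split_ord /=.
under eq_bigr => x _ do rewrite big_split_ord /=.
under [X in _ + X]eq_bigr => x _ do rewrite big_split_ord /=.
rewrite !big_split /=.
under eq_bigr => x _ do under eq_bigr => y _ do rewrite !ltF eqxx.
under [X in _ + X + _]eq_bigr => x _ do
  under eq_bigr => y _ do rewrite ltF leq_addr addKn /=.
under [X in _ + (X + _)]eq_bigr => x _ do
  under eq_bigr => y _ do rewrite ltF leq_addr addKn /= eq_sym.
under [X in _ + (_ + X)]eq_bigr => x _ do
  under eq_bigr => y _ do rewrite !leq_addr eqxx.
rewrite [X in _ + X + _](exchange_big_dep predT) //=.
under [X in _ + X + _]eq_bigr => x _ do rewrite S.
under [X in _ + (X + _)]eq_bigr => x _ do rewrite S.
rewrite !sumr_const !card_ord natrD !expnS !expn0 !muln1 !natrM.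
by ring.
Qed.

Section Casimir.
Variables (C : numClosedFieldType) (n d r1 r2 : nat).
Hypotheses (hn : n = (r1 + r2)%N) (hr : (r2 <= r1)%N).
Implicit Types (s t p q : 'S_n) (x y z : 'I_n).
Local Notation lam := [:: r1; r2].
Local Notation P s := (@perm_op C n d s).
Local Notation Y := (young_symmetrizer C n d lam).

(** With ordered pairs and [x = y] allowed, this is twice the sum of all transpositions plus [n]
    times the identity. *)
Definition swap_sum : 'M[C]_(tdim n d) :=
  \sum_(x : 'I_n) \sum_(y : 'I_n) P (tperm x y).

Lemma swap_sum_central s : P s *m swap_sum = swap_sum *m P s.
Proof.
rewrite mulmx_sumr mulmx_suml (reindex_inj (@perm_inj _ s)) /=.
apply: eq_bigr => x _; rewrite mulmx_sumr mulmx_suml.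
rewrite (reindex_inj (@perm_inj _ s)) /=; apply: eq_bigr => y _.
by rewrite !perm_opM -tpermJ conjgE !mulgA mulgV mul1g.
Qed.

Definition cell_weight (x y : 'I_n) : C :=
  if reshape_index lam x == reshape_index lam y then 1
  else if reshape_offset lam x == reshape_offset lam y then -1 else 0.

Local Notation rowS := (\sum_(p in row_stab n lam) P p).
Local Notation colS :=
  (\sum_(q in col_stab n lam) (-1) ^+ odd_perm q *: P q).

Lemma tperm_row_stab (x y : 'I_n) : reshape_index lam x = reshape_index lam y ->
  tperm x y \in row_stab n lam.
Proof.
by move=> e; rewrite inE; apply/forallP => i; case: tpermP => [->|->|//]; rewrite e.
Qed.

Lemma tperm_col_stab (x y : 'I_n) : reshape_offset lam x = reshape_offset lam y ->
  tperm x y \in col_stab n lam.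
Proof.
by move=> e; rewrite inE; apply/forallP => i; case: tpermP => [->|->|//]; rewrite e.
Qed.

(* If [z] is in the row of [x] and in the column of [y], then
   (x z)(x y) = (x y)(y z), so that rowS (x y) colS equals its opposite. *)
Lemma row_tperm_col_eq0 (x y z : 'I_n) : z != x -> z != y ->
  reshape_index lam x = reshape_index lam z ->
  reshape_offset lam y = reshape_offset lam z ->
  rowS *m P (tperm x y) *m colS = 0.
Proof.
move=> zx zy rx cy.
have e : (tperm x z * tperm x y = tperm x y * tperm y z)%g.
  have := tpermJ x z (tperm x y); rewrite tpermL tpermD 1?eq_sym // => <-.
  by rewrite conjgE !mulgA mulgV mul1g.
set A := LHS; suff : A = - A.
  by move/eqP; rewrite -addr_eq0 -mulr2n -scaler_nat scaler_eq0 pnatr_eq0 => /eqP.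
rewrite {1}/A -{1}(row_sum_perm_op C d (tperm_row_stab rx)).
rewrite -(mulmxA rowS) perm_opM e -perm_opM !mulmxA -(mulmxA _ _ colS).
rewrite perm_op_col_sum ?tperm_col_stab // odd_tperm eq_sym zy expr1 scaleN1r.
by rewrite mulmxN.
Qed.

(** A transposition within a row is absorbed by the row sum, one within a column by the signed
    column sum at the cost of a sign. Two cells sharing neither have a corner cell, and the product
    vanishes. *)
Lemma row_tperm_col x y :
  rowS *m P (tperm x y) *m colS = cell_weight x y *: (rowS *m colS).
Proof.
rewrite /cell_weight; case: eqVneq => [e|ne].
  by rewrite row_sum_perm_op ?tperm_row_stab // scale1r.
case: eqVneq => [e|nc].
  rewrite -mulmxA perm_op_col_sum ?tperm_col_stab // odd_tperm.
  case: (eqVneq x y) ne => [->|_ _] /=; first by rewrite eqxx.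
  by rewrite expr1 scalemxAr.
rewrite scale0r.
(* By symmetry [x] lies in the first row and [y] in the second. The corner cell is the one above
   [y], numbered [y - r1]; it exists because [r2 <= r1]. *)
wlog le : x y ne nc / (r1 <= y)%N && ~~ (r1 <= x)%N => [W|].
  have := ne; rewrite !reshape_index_two_rows -?hn // eqn_leq.
  case E1: (r1 <= x)%N; case E2: (r1 <= y)%N => //= _.
    by rewrite tpermC; apply: W; rewrite 1?eq_sym ?E1 ?E2.
  by apply: W; rewrite ?E1 ?E2.
case/andP: le => ly lx.
have lt2 : (y - r1 < r2)%N by rewrite ltn_subLR // -hn.
have ltz : (y - r1 < n)%N by apply: leq_trans lt2 _; rewrite [leqRHS]hn leq_addl.
have ltz1 : (y - r1 < r1)%N by exact: leq_trans lt2 hr.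
move: nc; rewrite !reshape_offset_two_rows -?hn // ly (negPf lx) => nc.
apply: (@row_tperm_col_eq0 x y (Ordinal ltz)).
- by rewrite -val_eqE /= eq_sym.
- by rewrite -val_eqE /= neq_ltn (leq_trans ltz1 ly).
- by rewrite !reshape_index_two_rows -?hn //= (negPf lx) leqNgt ltz1.
- by rewrite !reshape_offset_two_rows -?hn //= ly (leqNgt r1) ltz1.
Qed.

Lemma sum_cell_weight : \sum_x \sum_y cell_weight x y =
  (r1 ^ 2 + r2 ^ 2)%N%:R - r2%:R *+ 2.
Proof.
rewrite -(sum_two_row_weight C hr hn); apply: eq_bigr => x _.
apply: eq_bigr => y _; rewrite /cell_weight /two_row_weight.
rewrite !reshape_index_two_rows -?hn // !reshape_offset_two_rows -?hn //.
by case: (r1 <= x)%N; case: (r1 <= y)%N.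
Qed.

(** Being central, [swap_sum] can be placed between the row sum and the signed column sum, where
    each transposition becomes its [cell_weight]. *)
Lemma young_symmetrizer_swap_sum :
  Y *m swap_sum = ((r1 ^ 2 + r2 ^ 2)%N%:R - r2%:R *+ 2) *: Y.
Proof.
rewrite young_symmetrizer_mul -mulmxA.
have -> : colS *m swap_sum = swap_sum *m colS.
  rewrite [LHS]mulmx_suml [RHS]mulmx_sumr; apply: eq_bigr => q _.
  by rewrite -scalemxAl -scalemxAr swap_sum_central.
rewrite mulmxA [X in X *m _ = _]mulmx_sumr [LHS]mulmx_suml -sum_cell_weight.
rewrite scaler_suml; apply: eq_bigr => x _.
rewrite [X in X *m _ = _]mulmx_sumr [LHS]mulmx_suml scaler_suml.
by apply: eq_bigr => y _; rewrite row_tperm_col.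
Qed.

End Casimir.

(** * A nonzero diagonal entry of the Young symmetrizer *)

Section YoungDiagonal.
Variables (C : numClosedFieldType) (n d r1 r2 N : nat).
Hypotheses (hn : n = (r1 + r2)%N) (hr : (r2 <= r1)%N).
Hypotheses (hN2 : (r2 <= N)%N) (hN1 : (N <= r1)%N).
Variables (o0 o1 : 'I_d).
Hypothesis o01 : o0 != o1.
Local Notation lam := [:: r1; r2].
Local Notation P s := (@perm_op C n d s).
Local Notation Y := (young_symmetrizer C n d lam).

(* The second row is filled with o0 and every column of length two has o1 above
   o0, so no column permutation but the identity preserves the row contents. *)
Definition tableau_state : {ffun 'I_n -> 'I_d} :=
  [ffun i : 'I_n => if (i < r2)%N then o1 else if (i < N)%N then o0
           else if (i < r1)%N then o1 else o0].

Lemma tableau_col_stab (p q : 'S_n) :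
  p \in row_stab n lam -> q \in col_stab n lam ->
  tableau_state = shuffle (p * q)%g tableau_state -> q = 1%g.
Proof.
rewrite !inE => /forallP pR /forallP qC T.
have ltn (x : 'I_n) : (x < r1 + r2)%N by rewrite -hn.
have qo (x : 'I_n) := eqP (qC x).
(* Row permutations keep second-row cells in the second row, where all letters are [o0]; so [q]
   sends such a cell [x] to a letter [o0]. The cell above [x] carries [o1], hence [q x = x]. *)
have qbot (x : 'I_n) : (r1 <= x)%N -> q x = x.
  move=> bx; have := qo x.
  have := eqP (pR (p^-1 x)%g); rewrite permKV !reshape_index_two_rows // bx => px.
  have := congr1 (fun f : {ffun 'I_n -> 'I_d} => f (p^-1 x)%g) T.
  rewrite !ffunE permM permKV !reshape_offset_two_rows // bx.
  have ltqx := ltn (q x); have ltx := ltn x.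
  case: (leqP r1 (p^-1 x)%g) px => // bpx _.
  rewrite (_ : ((p^-1)%g x < r2)%N = false); last by lia.
  rewrite (_ : ((p^-1)%g x < N)%N = false); last by lia.
  case: (ltnP (q x) r2) => [lt /eqP|ge _ e]; first by rewrite (negPf o01).
  by apply: val_inj => /=; move: e; case: leqP => /=; lia.
apply/permP => x; rewrite perm1.
case: (leqP r1 x) => bx; first exact: qbot.
have := qo x; rewrite !reshape_offset_two_rows // (leqNgt r1 x) bx /=.
case: (leqP r1 (q x)) => bq e; last exact: val_inj.
have := qbot _ bq => /perm_inj qx; move: bq; rewrite qx; lia.
Qed.

(** Only [q = 1] contributes, so no sign survives: the entry counts the row permutations preserving
    the word, the identity among them. *)
Lemma young_symmetrizer_tableau :
  Y (enum_rank tableau_state) (enum_rank tableau_state) != 0.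
Proof.
set T := enum_rank _.
have -> : Y T T =
    \sum_(p in row_stab n lam) (tableau_state == shuffle p tableau_state)%:R.
  rewrite summxE; apply: eq_bigr => p pR; rewrite summxE (bigD1 1%g) /=; last first.
    by rewrite inE; apply/forallP => i; rewrite perm1.
  rewrite odd_perm1 expr0 scale1r perm_opM mulg1 perm_opE enum_rankK.
  rewrite big1 ?addr0 // => q /andP[qC q1].
  rewrite mxE perm_opM perm_opE enum_rankK; case: eqP => [e|_]; last by rewrite mulr0.
  by move: q1; rewrite (tableau_col_stab pR qC e) eqxx.
rewrite (bigD1 1%g) /=; last by rewrite inE; apply/forallP => i; rewrite perm1.
by rewrite shuffle1 eqxx gt_eqF // ltr_wpDr // sumr_ge0.
Qed.

End YoungDiagonal.

Section BlockSwap.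
Variables (n r1 r2 : nat).
Hypotheses (hn : n = (r1 + r2)%N) (hr : (r2 <= r1)%N).

(** Exchanges the two cells of every column of length two, which sorts the word [tableau_state] into
    letters [o0] followed by letters [o1]. *)
Definition block_swap_fun (i : nat) : nat :=
  if (i < r2)%N then (i + r1)%N else if (r1 <= i)%N then (i - r1)%N else i.

Lemma block_swap_lt (i : 'I_n) : (block_swap_fun i < n)%N.
Proof.
have := ltn_ord i; have := hn; rewrite /block_swap_fun.
by case: ifP; [|case: ifP]; lia.
Qed.

Lemma block_swap_inj : injective (fun i => Ordinal (block_swap_lt i)).
Proof.
move=> i j /(congr1 val) /= e; apply: val_inj => /=.
have := ltn_ord i; have := ltn_ord j; have := hn.
move: e; rewrite /block_swap_fun.
by do 2!case: ifP; do ?case: ifP; lia.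
Qed.

Definition block_swap : 'S_n := perm block_swap_inj.

End BlockSwap.

Lemma shuffle_block_swap n d r1 r2 N (hn : n = (r1 + r2)%N) (hr : (r2 <= r1)%N)
    (o0 o1 : 'I_d) : (r2 <= N)%N -> (N <= r1)%N ->
  shuffle (block_swap hn hr) (tableau_state n r1 r2 N o0 o1) =
  [ffun i : 'I_n => if (i < N)%N then o0 else o1].
Proof.
move=> hN2 hN1; apply/ffunP => i; rewrite !ffunE permE /= /block_swap_fun.
have lti := ltn_ord i.
case: (ltnP i r2) => h1.
  by rewrite (leq_trans h1 hN2) !ifF //; lia.
case: (leqP r1 i) => h2.
  by rewrite ifT ?ifF //; lia.
by rewrite h2 (ltnNge i r2) h1.
Qed.

(** * Outcome probabilities are polynomials in the overlap *)

Lemma poly_eq_unit_itv (R : realFieldType) (p q : {poly R}) :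
  (forall t, 0 <= t <= 1 -> p.[t] = q.[t]) -> p = q.
Proof.
move=> pq; apply/eqP; rewrite -subr_eq0; apply/eqP.
(* Enough distinct points of the unit interval to exceed the degree of [p - q]. *)
pose rs := [seq (i.+1%:R)^-1 : R | i <- iota 0 (size (p - q))].
apply: (@roots_geq_poly_eq0 _ _ rs); last by rewrite size_map size_iota.
  apply/allP => _ /mapP[i _ ->]; rewrite /root hornerD hornerN subr_eq0 pq //.
  by rewrite invr_ge0 ler0n invf_le1 ?ltr0n // ler1n.
rewrite map_inj_uniq ?iota_uniq // => a b /invr_inj /eqP.
by rewrite eqr_nat eqSS => /eqP.
Qed.

Section ProductStates.
Variables (R : realType) (d N M : nat).
Local Notation C := R[i].
Local Notation n := (N + M)%N.
Local Notation P s := (@perm_op C n d s).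
Implicit Types (s : 'S_n) (psi phi : 'rV[C]_d).

Lemma dotmx_sum m (u v : 'rV[C]_m) : dotmx u v = \sum_x u 0 x * (v 0 x)^*.
Proof. by rewrite dotmxE mxE; apply: eq_bigr => x _; rewrite !mxE. Qed.

Lemma dotmx_suml m (I : Type) (r : seq I) (F : I -> 'rV[C]_m) (v : 'rV[C]_m) :
  dotmx (\sum_(i <- r) F i) v = \sum_(i <- r) dotmx (F i) v.
Proof.
by rewrite dotmxE mulmx_suml summxE; apply: eq_bigr => i _; rewrite dotmxE.
Qed.

Lemma dotmxZl m (a : C) (u v : 'rV[C]_m) : dotmx (a *: u) v = a * dotmx u v.
Proof. by rewrite !dotmxE -scalemxAl mxE. Qed.

Lemma dotmxC m (u v : 'rV[C]_m) : dotmx u v = (dotmx v u)^*.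
Proof.
rewrite !dotmx_sum rmorph_sum; apply: eq_bigr => x _.
by rewrite rmorphM /= conjCK mulrC.
Qed.

Lemma overlapE psi phi : (overlap psi phi)%:C = dotmx psi phi * (dotmx psi phi)^*.
Proof. by rewrite -normCK /overlap RRe_real // ger0_real // exprn_ge0. Qed.

Definition crossing s : nat := #|[set i : 'I_n | (i < N)%N && (N <= s i)%N]|.

Lemma card_ltn_ord : #|[set i : 'I_n | (i < N)%N]| = N.
Proof.
rewrite -[RHS]card_ord -(card_imset _ (@lshift_inj N M)).
apply: eq_card => i; rewrite inE; apply/idP/imsetP => [lt|[x _ ->]].
  by exists (Ordinal lt) => //; apply: val_inj.
exact: (ltn_ord x).
Qed.

Lemma card_preim_ltn_ord s : #|[set i : 'I_n | (s i < N)%N]| = N.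
Proof.
rewrite -[RHS]card_ltn_ord -[RHS](card_imset _ (@perm_inj _ (s^-1)%g)).
apply: eq_card => i; rewrite inE; apply/idP/imsetP => [lt|[x]].
  by exists (s i); rewrite ?inE ?permK.
by rewrite inE => ltx ->; rewrite permKV.
Qed.

(** A bijection moves as many positions out of the first block as into it: either count completes
    the positions staying there to [N]. *)
Lemma crossing_sym s : #|[set i : 'I_n | (N <= i)%N && (s i < N)%N]| = crossing s.
Proof.
apply: (@addnI #|[set i : 'I_n | (i < N)%N && (s i < N)%N]|).
transitivity #|[set i : 'I_n | (s i < N)%N]|.
  rewrite -[RHS](cardsID [set i : 'I_n | (i < N)%N]).
  by congr (_ + _)%N; apply: eq_card => i; rewrite !inE -?leqNgt // andbC.
rewrite card_preim_ltn_ord -[LHS]card_ltn_ord.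
rewrite -[LHS](cardsID [set i : 'I_n | (s i < N)%N]).
by congr (_ + _)%N; apply: eq_card => i; rewrite !inE -?leqNgt // andbC.
Qed.

(** The expectation factorizes over the tensor factors. Crossings in one direction give
    [dotmx psi phi], those in the other its conjugate, all remaining factors 1; both directions
    occur equally often. *)
Lemma dot_product_state psi phi s : unit_state psi -> unit_state phi ->
  dotmx (product_state N M psi phi *m P s) (product_state N M psi phi) =
  (overlap psi phi)%:C ^+ crossing s.
Proof.
move=> upsi uphi; rewrite dotmx_sum.
pose v (i : 'I_n) := if (i < N)%N then psi else phi.
have -> : \sum_x (product_state N M psi phi *m P s) 0 x *
    (product_state N M psi phi 0 x)^* =
    \sum_(f : {ffun 'I_n -> 'I_d}) \prod_i (v ((s^-1)%g i) 0 (f i) * (v i 0 (f i))^*).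
  rewrite (reindex (@enum_val {ffun 'I_n -> 'I_d} predT)) /=; last first.
    by exists enum_rank => x _; [exact: enum_valK | exact: enum_rankK].
  apply: eq_bigr => x _; rewrite mulmx_perm_op !mxE enum_rankK big_split /= rmorph_prod.
  congr (_ * _).
  rewrite [RHS](reindex_inj (@perm_inj _ s)) /=; apply: eq_bigr => i _.
  by rewrite permK ffunE.
rewrite -(bigA_distr_bigA (fun i x => v ((s^-1)%g i) 0 x * (v i 0 x)^*)) /=.
under eq_bigr do rewrite -dotmx_sum.
rewrite (reindex_inj (@perm_inj _ s)) /=.
under eq_bigr do rewrite permK.
have E i : dotmx (v i) (v (s i)) =
    (if (i < N)%N && (N <= s i)%N then dotmx psi phi else 1) *
    (if (N <= i)%N && (s i < N)%N then (dotmx psi phi)^* else 1).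
  rewrite /v; case: ltnP => _; case: ltnP => _ /=; rewrite ?mulr1 ?mul1r.
  - exact: upsi.
  - by [].
  - exact: dotmxC.
  - exact: uphi.
under eq_bigr do rewrite E.
rewrite big_split /= -!big_mkcond /= !prodr_const overlapE exprMn.
congr (_ ^+ _ * _ ^+ _); last rewrite -crossing_sym;
  by apply: eq_card => i; rewrite inE.
Qed.

Lemma conj_real_complex (r : R) : (r%:C)^* = r%:C.
Proof. by rewrite /Num.conj /=; simpc. Qed.

Lemma Re_mul_real (x : C) (r : R) : complex.Re (x * r%:C) = complex.Re x * r.
Proof. by case: x => a b /=; rewrite mulr0 subr0. Qed.

Lemma outcome_prob_ge0 j psi phi : 0 <= outcome_prob N M j psi phi.
Proof.
rewrite /outcome_prob /= dot_proj_ortho dotmx_sum raddf_sum /=.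
apply: sumr_ge0 => x _; rewrite -normCK.
have := exprn_ge0 2 (normr_ge0 ((product_state N M psi phi *m Pi_J R d N M j) 0 x)).
by rewrite lecE => /andP[].
Qed.

(** Two coordinates suffice, with [sqrt c] and [sqrt (1 - c)]. Hence [cond_prob] never takes its
    default value on the domain of integration. *)
Lemma ex_overlap_states (c : R) : (2 <= d)%N -> 0 <= c <= 1 ->
  exists psi phi, [/\ unit_state psi, unit_state phi & overlap psi phi = c].
Proof.
move=> hd /andP[c0 c1].
pose o0 : 'I_d := Ordinal (ltnW hd); pose o1 : 'I_d := Ordinal hd.
have o10 : o1 != o0 by [].
pose mk (a b : R) : 'rV[C]_d :=
  \row_i (if i == o0 then a%:C else if i == o1 then b%:C else 0).
have dE a b a' b' : dotmx (mk a b) (mk a' b') = (a * a' + b * b')%:C.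
  rewrite dotmx_sum (bigD1 o0) //= (bigD1 o1) //= big1 => [|i /andP[i0 i1]].
    rewrite !mxE /= addr0 rmorphD !rmorphM /=.
    by rewrite !conj_real_complex.
  by rewrite !mxE (negPf i0) (negPf i1) mul0r.
exists (mk 1 0), (mk (Num.sqrt c) (Num.sqrt (1 - c))); split.
- by rewrite /unit_state dE mulr0 addr0 mulr1.
- rewrite /unit_state dE -!expr2 !sqr_sqrtr ?subr_ge0 //.
  by rewrite addrC subrK.
- apply: (fmorph_inj (real_complex R)); rewrite /= overlapE dE mul1r mul0r addr0.
  by rewrite conj_real_complex -rmorphM -expr2 sqr_sqrtr.
Qed.

(** The coefficients of the projector on the permutation operators give the polynomial. The second
    clause is the Casimir eigenvalue equation read on expectations; the third makes the denominator
    of the posterior mean positive. *)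
Lemma outcome_polynomial j : (2 <= d)%N -> (N <= M)%N -> (j <= N)%N ->
  exists x : 'S_n -> R, let g := \sum_s (x s)%:P * 'X^(crossing s) in
  [/\ forall psi phi, unit_state psi -> unit_state phi ->
        outcome_prob N M j psi phi = g.[overlap psi phi],
      \sum_s (x s)%:P * (\sum_a \sum_b 'X^(crossing (s * tperm a b)%g)) =
        (((M + j) ^ 2 + (N - j) ^ 2)%N%:R - (N - j)%:R *+ 2) *: g
    & 0 < g.[0]].
Proof.
move=> hd hNM hj.
have hr : (N - j <= M + j)%N by lia.
have hn : n = ((M + j) + (N - j))%N by lia.
have [x xE] := perm_alg_proj_block C n d [:: (M + j)%N; (N - j)%N].
have ZE := proj_block_central_eigen (@swap_sum_central C n d)
  (young_symmetrizer_swap_sum C d hn hr).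
set k := (X in X *: proj_ortho _) in ZE.
set k' : R := ((M + j) ^ 2 + (N - j) ^ 2)%N%:R - (N - j)%:R *+ 2.
have kE : k = k'%:C by rewrite /k /k' rmorphB !rmorphMn rmorph1.
(* Real parts suffice, because the powers of the overlap are real. *)
exists (fun s => complex.Re (x s)) => g.
have gE psi phi : unit_state psi -> unit_state phi ->
    outcome_prob N M j psi phi = g.[overlap psi phi].
  move=> upsi uphi; rewrite /outcome_prob /Pi_J xE mulmx_sumr dotmx_suml /=.
  rewrite raddf_sum horner_sum; apply: eq_bigr => s _.
  rewrite -scalemxAr dotmxZl dot_product_state // -rmorphXn /= Re_mul_real.
  by rewrite hornerM hornerC hornerXn.
split=> //.
- apply: poly_eq_unit_itv => t t01.
  have [psi [phi [upsi uphi <-]]] := ex_overlap_states hd t01.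
  rewrite hornerZ -gE //.
  (* Both sides are the expectation of [Pi_J *m swap_sum]: once with both operators expanded, once
     with the eigenvalue on the block. *)
  transitivity (complex.Re (dotmx (product_state N M psi phi *m
      (Pi_J R d N M j *m swap_sum C n d)) (product_state N M psi phi))).
    rewrite /Pi_J {1}xE mulmx_suml mulmx_sumr dotmx_suml raddf_sum /= horner_sum.
    apply: eq_bigr => s _; rewrite hornerM hornerC horner_sum.
    rewrite -scalemxAl -scalemxAr dotmxZl.
    rewrite mulmx_sumr mulmx_sumr dotmx_suml [in RHS]mulr_sumr raddf_sum /= [LHS]mulr_sumr.
    apply: eq_bigr => a _.
    rewrite mulmx_sumr mulmx_sumr dotmx_suml [in RHS]mulr_sumr raddf_sum /= horner_sum [LHS]mulr_sumr.
    apply: eq_bigr => b _; rewrite perm_opM dot_product_state // -rmorphXn /=.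
    by rewrite Re_mul_real hornerXn.
  rewrite ZE -scalemxAr dotmxZl kE mulrC Re_mul_real mulrC.
  by [].
- pose o0 : 'I_d := Ordinal (ltnW hd); pose o1 : 'I_d := Ordinal hd.
  have o01 : o0 != o1 by [].
  pose psi : 'rV[C]_d := delta_mx 0 o0; pose phi : 'rV[C]_d := delta_mx 0 o1.
  have dd a b : dotmx (delta_mx 0 a : 'rV[C]_d) (delta_mx 0 b) = (a == b)%:R.
    rewrite dotmx_sum (bigD1 a) //= big1 => [|i /negPf ia].
      by rewrite !mxE !eqxx /= mul1r addr0 conjC_nat.
    by rewrite !mxE ia andbF mul0r.
  have upsi : unit_state psi by rewrite /unit_state dd eqxx.
  have uphi : unit_state phi by rewrite /unit_state dd eqxx.
  have ov : overlap psi phi = 0.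
    by rewrite /overlap dd (negPf o01) normr0 expr0n.
  have <- : outcome_prob N M j psi phi = g.[0] by rewrite gE // ov.
  rewrite lt_neqAle outcome_prob_ge0 andbT eq_sym.
  set Psi := product_state N M psi phi; set W := schur_weyl_block C n d _ in xE ZE.
  (* A vanishing probability would make [Psi] orthogonal to the block, in particular to the rows of
     [Y *m P s^-1]. Moving the permutation onto [Psi] gives the basis vector of [T], so the diagonal
     entry of [Y] at [T] would be 0. *)
  apply/negP => /eqP out0.
  have d0 : dotmx (Psi *m proj_ortho W) (Psi *m proj_ortho W) = 0.
    have ge0 : 0 <= dotmx (Psi *m proj_ortho W) (Psi *m proj_ortho W).
      exact: dnorm_ge0.
    by rewrite -(RRe_real (ger0_real ge0)) -dot_proj_ortho -[RHS](rmorph0 (real_complex R));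
       congr (_%:C).
  have Psi0 : Psi *m proj_ortho W = 0.
    by apply/eqP; rewrite -(dnorm_eq0 (@dotmx C _)); apply/eqP; exact: d0.
  pose Y := young_symmetrizer C n d [:: (M + j)%N; (N - j)%N].
  pose s := block_swap hn hr.
  have YW : (Y *m P s^-1 <= W)%MS by apply: (sumsmx_sup (s^-1)%g).
  have := sub_proj_ortho_mul_adj Psi YW; rewrite Psi0 subr0.
  rewrite trmx_mul map_mxM perm_opV invgK mulmxA.
  pose T := tableau_state n (M + j) (N - j) N o0 o1.
  have -> : Psi *m P s = delta_mx 0 (enum_rank T).
    apply/rowP => b; rewrite mulmx_perm_op !mxE enum_rankK /=.
    have TE := shuffle_block_swap hn hr o0 o1 (leq_subr j N)
      (leq_trans hNM (leq_addr j M)); rewrite -/T -/s in TE.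
    have factor (f : {ffun 'I_n -> 'I_d}) (i : 'I_n) :
        (if (i < N)%N then psi else phi) 0 (f i) = (f i == shuffle s T i)%:R.
      by rewrite TE ffunE; case: ifP; rewrite !mxE.
    under eq_bigr do rewrite factor.
    case: eqVneq => [->|neq].
      by rewrite enum_rankK big1 // => i _; rewrite eqxx.
    apply/eqP; apply: contra_neqT neq => /prodf_neq0 nz.
    have : shuffle s (enum_val b) = shuffle s T.
      apply/ffunP => i; have := nz i isT; rewrite pnatr_eq0 eqb0 negbK.
      by move/eqP.
    move/(congr1 (shuffle s^-1)); rewrite !shuffleM mulVg !shuffle1 => <-.
    by rewrite enum_valK.
  rewrite -rowE => /rowP /(_ (enum_rank T)) /eqP; rewrite !mxE conjC_eq0.
  apply/negP; apply: (young_symmetrizer_tableau C hn hr (leq_subr j N) _ o01).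
  exact: leq_trans hNM (leq_addr j M).
Qed.

End ProductStates.

(** * Composing with transpositions *)

Section CrossingCounts.
Variables (N M : nat).
Local Notation n := (N + M)%N.
Implicit Types s : 'S_n.
Local Notation k s := (@crossing N M s).
Local Open Scope nat_scope.

Local Notation u s := (fun x : 'I_n => ((s^-1)%g x < N)%N).
Local Notation v := (fun x : 'I_n => (N <= x)%N).

Lemma crossingM_sum s (t : 'S_n) :
  k (s * t)%g = \sum_x (u s x && v (t x)).
Proof.
rewrite /crossing -sum1_card big_mkcond /= (reindex_inj (@perm_inj _ (s^-1)%g)) /=.
by apply: eq_bigr => x _; rewrite inE permM permKV; case: (_ && _).
Qed.

Lemma crossing_sum s : k s = \sum_x (u s x && v x).
Proof.
by rewrite -[in LHS](mulg1 s) crossingM_sum; apply: eq_bigr => x _; rewrite perm1.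
Qed.

(** Only the positions [a] and [b] change their contribution. The form is additive because
    subtraction of naturals truncates. *)
Lemma crossing_tperm s a b :
  (k (s * tperm a b)%g + (u s a && v a) + (u s b && v b) =
   k s + (u s a && v b) + (u s b && v a))%N.
Proof.
rewrite crossingM_sum crossing_sum.
have [->|ab] := eqVneq a b.
  by rewrite tperm1; under eq_bigr do rewrite perm1.
rewrite (bigD1 a) //= (bigD1 b) 1?eq_sym //= tpermL tpermR.
rewrite [in RHS](bigD1 a) //= [in RHS](bigD1 b) 1?eq_sym //=.
rewrite (eq_bigr (fun x => u s x && v x : nat)); last first.
  by move=> x /andP[xa xb]; rewrite tpermD // eq_sym.
by move: (\sum_(i | _) _)%N => c; lia.
Qed.

Lemma crossing_le s : (k s <= N)%N.
Proof.
rewrite -[leqRHS](@card_ltn_ord N M); apply: subset_leq_card.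
by apply/fintype.subsetP => x; rewrite !inE => /andP[].
Qed.

Lemma sum_image_first s : \sum_x (u s x : nat) = N.
Proof.
rewrite -[RHS](@card_preim_ltn_ord N M (s^-1)%g) -sum1_card [RHS]big_mkcond /=.
by apply: eq_bigr => x _; rewrite inE; case: ltnP.
Qed.

Lemma sum_last : \sum_x (v x : nat) = M.
Proof.
apply: (@addnI N); rewrite -{1}(@card_ltn_ord N M) -sum1_card big_mkcond /=.
rewrite -big_split /= -[RHS]card_ord -sum1_card; apply: eq_bigr => x _.
by rewrite inE; case: ltnP.
Qed.

(** By origin block and arrival block, positions fall into four classes: [k s] cross from first to
    last, and this lemma and the next two count those staying first, staying last, and crossing
    back. *)
Lemma sum_image_first_Nlast s : \sum_x (u s x && ~~ v x : nat) = (N - k s)%N.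
Proof.
apply: (@addnI (k s)); rewrite subnKC ?crossing_le // crossing_sum -big_split.
by rewrite -[RHS](sum_image_first s); apply: eq_bigr => x _; case: (u s x); case: (v x).
Qed.

Lemma sum_Nimage_first_last s : \sum_x (~~ u s x && v x : nat) = (M - k s)%N.
Proof.
apply: (@addnI (k s)); rewrite crossing_sum -big_split /=.
rewrite subnKC; last first.
  by rewrite -[leqRHS]sum_last; apply: leq_sum => x _; case: (u s x); case: (v x).
by rewrite -[RHS]sum_last; apply: eq_bigr => x _; case: (u s x); case: (v x).
Qed.

Lemma sum_Nimage_first_Nlast s : \sum_x (~~ u s x && ~~ v x : nat) = k s.
Proof.
apply: (@addnI (\sum_x (u s x && ~~ v x : nat))%N).
rewrite {2}sum_image_first_Nlast subnK ?crossing_le // -big_split /=.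
apply: (@addIn M); rewrite -[X in _ + X = _]sum_last -big_split /= -[RHS]card_ord -sum1_card.
by apply: eq_bigr => x _; case: (u s x); case: (v x).
Qed.

End CrossingCounts.

Section CrossingSums.
Variables (N M : nat).
Local Notation n := (N + M)%N.
Implicit Types s : 'S_n.
Local Notation k s := (@crossing N M s).
Local Notation u s := (fun x : 'I_n => ((s^-1)%g x < N)%N).
Local Notation v := (fun x : 'I_n => (N <= x)%N).

(** The exponent rises when a factor staying in the first block is exchanged with one staying in the
    last, and falls when two factors crossing in opposite directions are exchanged. The factors 2
    count ordered pairs; at [k s = 0] the truncated predecessor has weight 0. *)
Lemma sum_expr_crossing_tperm (A : comNzRingType) (z : A) s :
  \sum_a \sum_b z ^+ k (s * tperm a b)%g =
  (n ^ 2)%:R * z ^+ k s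
  + (2 * ((N - k s) * (M - k s)))%:R * (z ^+ (k s).+1 - z ^+ k s)
  + (2 * k s ^ 2)%:R * (z ^+ (k s).-1 - z ^+ k s).
Proof.
set D1 := z ^+ (k s).+1 - _; set D2 := z ^+ (k s).-1 - _.
have step a b : z ^+ k (s * tperm a b)%g = z ^+ k s
   + (((u s a && ~~ v a) * (~~ u s b && v b)
     + (~~ u s a && v a) * (u s b && ~~ v b))%N)%:R * D1
   + (((u s a && v a) * (~~ u s b && ~~ v b)
     + (~~ u s a && ~~ v a) * (u s b && v b))%N)%:R * D2.
  have := crossing_tperm s a b; rewrite /D1 /D2.
  move: (k (s * tperm a b)%g) => m.
  case: (u s a); case: (v a); case: (u s b); case: (v b);
    rewrite /= ?addn0 ?addn1 ?mul0r ?mul1r ?addr0 => e;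
    first [ by move/addIn: e => -> | by rewrite e | by rewrite -e /=; ring | idtac ].
  all: try by rewrite -e /=; ring.
  all: try by (have -> : m = k s by lia).
  all: try by (have -> : m = (k s).+1 by lia); ring.
  all: try by (have -> : m = (k s).-1 by lia); ring.
under eq_bigr => a _ do under eq_bigr => b _ do rewrite step.
have dist (f g : 'I_n -> nat) :
    (\sum_a \sum_b f a * g b)%N = ((\sum_a f a) * (\sum_b g b))%N.
  by rewrite big_distrlr.
have split (f g f' g' : 'I_n -> nat) (D : A) :
  \sum_a \sum_b ((f a * g b + f' a * g' b)%N)%:R * D =
   ((\sum_a f a) * (\sum_b g b) + (\sum_a f' a) * (\sum_b g' b))%N%:R * D.
  rewrite -!dist -big_split natr_sum mulr_suml; apply: eq_bigr => a _ /=.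
  by rewrite -big_split natr_sum mulr_suml.
under eq_bigr => a _ do rewrite !big_split /=.
rewrite !big_split /= !split sum_image_first_Nlast sum_Nimage_first_last sum_Nimage_first_Nlast -crossing_sum.
rewrite !sumr_const !card_ord; congr (_ + _ + _).
- by rewrite -mulrnA mulr_natl.
- by congr (_%:R * _); move: (N - k s)%N (M - k s)%N => p q; ring.
- by congr (_%:R * _); ring.
Qed.

(* The Casimir relation sum_(a, b) p_J (s (a b)) = kappa p_J (s), integrated
   against moments [L 'X^k] obeying the recursion of the Beta(1, d - 1) law. *)
Lemma casimir_moments (R : realType) (L : {scalar {poly R}}) (d : nat)
    (x : 'S_n -> R) (g : {poly R}) (kappa : R) :
  (N <= M)%N ->
  (forall i, i.+1%:R * L 'X^i = (i + d)%:R * L 'X^(i.+1)) ->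
  g = \sum_s (x s)%:P * 'X^(k s) ->
  \sum_s (x s)%:P * (\sum_a \sum_b 'X^(k (s * tperm a b)%g)) = kappa *: g ->
  kappa * L g = (n%:R ^+ 2 - 2 * N%:R * M%:R - 2 * n%:R - 2 * d%:R) * L g
    + 2 * ((d%:R + M%:R) * (d%:R + N%:R)) * L ('X * g).
Proof.
move=> hNM hL -> gz; rewrite -linearZ -gz /=.
rewrite !raddf_sum /= mulr_sumr [X in L X]mulr_sumr raddf_sum mulr_sumr /=.
rewrite -big_split /=; apply: eq_bigr => s _.
have LZ c (p : {poly R}) : L (c *: p) = c * L p by exact: linearZ.
rewrite sum_expr_crossing_tperm (mulrCA 'X) -exprS !mul_polyC !LZ.
have LE m (p : {poly R}) : L (m%:R * p) = m%:R * L p.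
  by rewrite [m%:R * p]mulr_natl [LHS]raddfMn [RHS]mulr_natl.
rewrite 2!(linearD L) !LE !(linearB L) /=.
have kN := crossing_le s; move: (k s) kN => i iN.
(* The recursion at [i - 1], multiplied by [i] so that it also holds for [i = 0]. *)
have h2 : i%:R * (i%:R * L 'X^(i.-1)) = i%:R * ((i%:R - 1 + d%:R) * L 'X^i).
  case: i {iN} => [|i]; first by rewrite !mul0r.
  by rewrite /= hL natrD -natr1; ring.
have h1 := hL i; rewrite -natr1 natrD in h1.
rewrite !natrM !natrB ?(leq_trans iN) // natrD.
set a := L 'X^i in h1 h2 *; set b := L 'X^(i.+1) in h1 *; set c := L 'X^(_.-1) in h2 *.
move: (i%:R) (N%:R) (M%:R) (d%:R) (x s) h1 h2 => I NN MM D y h1 h2.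
have h1' : b * (I + D) = (I + 1) * a by rewrite mulrC -h1.
have -> : 2 * (I * I) * (c - a) = 2 * (I * (I * c)) - 2 * I ^+ 2 * a by ring.
rewrite h2 [RHS](_ : _ = y * ((((NN + MM) ^+ 2 - 2 * NN * MM - 2 * (NN + MM) - 2 * D) * a
   + 2 * ((D + MM) * (D + NN)) * b))); last by ring.
congr (y * _); apply/eqP; rewrite -subr_eq0; apply/eqP.
transitivity (2 * (NN + MM + D - I) * ((I + 1) * a - b * (I + D))); first by ring.
by rewrite h1' subrr mulr0.
Qed.

End CrossingSums.

(** * Moments of the overlap density *)

Local Open Scope classical_set_scope.
Local Open Scope ring_scope.

Section PolynomialIntegral.
Variable R : realType.
Implicit Types p q : {poly R}.
Local Notation mu := (@lebesgue_measure R).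

Lemma integrable_horner p (a b : R) :
  mu.-integrable `[a, b] (EFin \o horner p).
Proof.
apply: continuous_compact_integrable; first exact: segment_compact.
by apply: continuous_subspaceT => x; exact: continuous_horner.
Qed.

Definition poly_integral p : R := \int[mu]_(x in `[0, 1]) p.[x].

Lemma poly_integral_linear : scalar poly_integral.
Proof.
move=> a p q; rewrite /poly_integral.
have mI : measurable (`[0, 1] : set R) by exact: measurable_itv.
rewrite -RintegralZl //; last exact: integrable_horner.
rewrite -RintegralD //.
- by apply: eq_Rintegral => x _; rewrite hornerD hornerZ.
- have -> : EFin \o (fun x => a * p.[x]) = EFin \o horner (a *: p).
    by apply/funext => x /=; rewrite hornerZ.
  exact: integrable_horner.
- exact: integrable_horner.
Qed.

HB.instance Definition _ :=
  GRing.isLinear.Build R {poly R} R *%R poly_integral poly_integral_linear.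

Lemma poly_integral_deriv p : poly_integral p^`() = p.[1] - p.[0].
Proof.
rewrite /poly_integral /Rintegral (@continuous_FTC2 _ (horner p^`()) (horner p)) //.
- by apply: continuous_subspaceT => x; exact: continuous_horner.
- split.
  + by move=> x _; exact: derivable_horner.
  + by apply: cvg_at_right_filter; exact: continuous_horner.
  + by apply: cvg_at_left_filter; exact: continuous_horner.
- by move=> x _; rewrite derivE.
Qed.

(** By continuity [p] exceeds half of [p.[0]] on some [[0, x]], which already contributes a positive
    amount. *)
Lemma poly_integral_gt0 p : (forall x, 0 <= x <= 1 -> 0 <= p.[x]) -> 0 < p.[0] ->
  0 < poly_integral p.
Proof.
move=> p0 pp.
have : \forall x \near (0 : R), p.[0] / 2 < p.[x].
  have pc : horner p x @[x --> (0 : R)] --> p.[0] by exact: continuous_horner.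
  apply: (cvgr_gt _ pc).
  by rewrite ltr_pdivrMr // ltr_pMr // ltr1n.
case/nbhs_ballP => e /= e0 he.
pose x : R := Num.min (e / 2) 1.
have x0 : 0 < x by rewrite lt_min divr_gt0 // ltr01.
have x1 : x <= 1 by rewrite ge_min lexx orbT.
have hx y : 0 <= y <= x -> p.[0] / 2 <= p.[y].
  case/andP => y0 yx; apply/ltW/he; rewrite /ball /= sub0r normrN ger0_norm //.
  rewrite (le_lt_trans yx) // /x gt_min ltr_pdivrMr // ltr_pMr //.
  by rewrite ltr1n.
rewrite /poly_integral -(subrK (\int[mu]_(t in `[0, x]) p.[t]) (\int[mu]_(_ in _) _)).
rewrite Rintegral_itvB; [|exact: integrable_horner|by rewrite bnd_simp ltW|by rewrite bnd_simp].
apply: ltr_wpDl.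
  apply: Rintegral_ge0 => y /=; rewrite in_itv /= => /andP[xy y1].
  by rewrite p0 // y1 andbT ltW // (lt_trans x0).
apply: (@lt_le_trans _ _ (\int[mu]_(t in `[0, x]) (p.[0] / 2))).
  rewrite Rintegral_cst //= lebesgue_measure_itv /= lte_fin x0 oppr0 adde0 /=.
  by rewrite mulr_gt0 // divr_gt0.
apply: le_Rintegral => //.
- have -> : EFin \o (fun=> p.[0] / 2) = EFin \o horner ((p.[0] / 2)%:P).
    by apply/funext => y /=; rewrite hornerC.
  exact: integrable_horner.
- exact: integrable_horner.
Qed.

Section BetaMoments.
Variables (d : nat) (hd : (2 <= d)%N).

Definition density_poly : {poly R} := (d%:R - 1) *: (1 - 'X) ^+ (d - 2).

Lemma horner_density_poly c : density_poly.[c] = overlap_density d c.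
Proof. by rewrite /density_poly hornerZ horner_exp !hornerE. Qed.

Definition overlap_mean p : R := poly_integral (density_poly * p).

Lemma overlap_mean_linear : scalar overlap_mean.
Proof. by move=> a p q; rewrite /overlap_mean mulrDr -scalerAr linearP. Qed.

HB.instance Definition _ :=
  GRing.isLinear.Build R {poly R} R *%R overlap_mean overlap_mean_linear.

Lemma one_subX1 : (1 - 'X : {poly R}).[1] = 0.
Proof. by rewrite hornerD hornerN hornerX hornerC subrr. Qed.

Lemma one_subX0 : (1 - 'X : {poly R}).[0] = 1.
Proof. by rewrite hornerD hornerN hornerX hornerC subr0. Qed.

(** The function [x ^ (i + 1) (1 - x) ^ (d - 1)] vanishes at 0 and at 1, as [2 <= d], so its
    derivative integrates to 0. *)
Lemma overlap_mean_recl i :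
  i.+1%:R * overlap_mean 'X^i = (i + d)%:R * overlap_mean 'X^(i.+1).
Proof.
have LZ c p : overlap_mean (c *: p) = c * overlap_mean p by exact: linearZ.
apply/eqP; rewrite -subr_eq0 -!LZ -linearB /=; apply/eqP.
have := poly_integral_deriv ((d%:R - 1) *: ('X^(i.+1) * (1 - 'X) ^+ (d - 1))).
rewrite !(hornerZ, hornerM, hornerXn, horner_exp) one_subX1 expr0n expr0n /=.
rewrite subn_eq0 leqNgt hd !mul0r !mulr0 subr0 => <-.
rewrite /overlap_mean; congr poly_integral.
rewrite /density_poly derivZ derivM derivXn deriv_exp derivB derivX (derivC 1) sub0r.
have -> : (d - 1 = (d - 2).+1)%N by rewrite -subSn.
have -> : (i + d)%:R = i%:R + (d - 2)%:R + 2 :> R.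
  by rewrite -[in LHS](subnK hd) addnA !natrD.
have -> : (d%:R - 1 : R) = (d - 2)%:R + 1.
  by rewrite -[in LHS](subnK hd) natrD -addrA; congr (_ + _); ring.
rewrite /= -natr1; move: (d - 2)%N => e.
rewrite -[_ *+ i.+1]scaler_nat -[_ *+ e.+1]scaler_nat -[i.+1%:R]natr1 -[e.+1%:R]natr1 !exprS.
move: (i%:R) (e%:R) => I E; rewrite (_ : I + E + 2 = (I + 1) + (E + 1)); last by ring.
by rewrite -!mul_polyC !polyCD polyC1; ring.
Qed.

Lemma overlap_mean1 : overlap_mean 1 = 1.
Proof.
have := poly_integral_deriv (- (1 - 'X) ^+ (d - 1)).
rewrite !hornerN !horner_exp one_subX1 one_subX0 expr1n expr0n.
rewrite subn_eq0 leqNgt hd /= oppr0 sub0r opprK => <-.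
rewrite /overlap_mean; congr poly_integral.
have -> : (d - 1 = (d - 2).+1)%N by rewrite -subSn.
rewrite /density_poly derivN deriv_exp derivB derivX (derivC 1) sub0r /=.
have -> : (d%:R - 1 : R) = (d - 2).+1%:R.
  by rewrite -natr1 -[in LHS](subnK hd) natrD -addrA; congr (_ + _); ring.
by rewrite mulr1 mulN1r mulNrn opprK scaler_nat.
Qed.

Lemma overlap_mean_gt0 p : (forall x, 0 <= x <= 1 -> 0 <= p.[x]) -> 0 < p.[0] ->
  0 < overlap_mean p.
Proof.
have d1 : 0 < d%:R - 1 :> R by rewrite subr_gt0 ltr1n.
move=> p0 pp; apply: poly_integral_gt0 => [x /andP[x0 x1]|].
  rewrite hornerM horner_density_poly mulr_ge0 // ?p0 ?x0 //.
  by rewrite /overlap_density mulr_ge0 // ?exprn_ge0 ?subr_ge0 // -subr_ge0 ltW.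
by rewrite hornerM horner_density_poly /overlap_density subr0 expr1n mulr1 mulr_gt0.
Qed.

End BetaMoments.
End PolynomialIntegral.

(** * Measurability on the space of states *)

Section StateSpace.
Variables (R : realType) (d : nat).
Local Notation C := R[i].

Definition state_carrier : Type := 'rV[C]_d.
HB.instance Definition _ := Choice.on state_carrier.
HB.instance Definition _ := isPointed.Build state_carrier (0 : 'rV[C]_d).

Definition state_space : Type :=
  g_sigma_algebraType (@state_cylinders R d : set_system state_carrier).
HB.instance Definition _ := Measurable.on state_space.

Lemma measurable_fun_Re (i : 'I_d) :
  measurable_fun setT (fun v : state_space => complex.Re (v 0 i)).
Proof.
move=> _ B mB; rewrite setTI; apply: sub_sigma_algebra.
by exists i, B; split => //; left.
Qed.

Lemma measurable_fun_Im (i : 'I_d) :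
  measurable_fun setT (fun v : state_space => complex.Im (v 0 i)).
Proof.
move=> _ B mB; rewrite setTI; apply: sub_sigma_algebra.
by exists i, B; split => //; right.
Qed.

Section Maps.
Variables (disp : measure_display) (S : measurableType disp).

Lemma measurable_fun_state (f : S -> state_space) :
  (forall i, measurable_fun setT (fun s => complex.Re (f s 0 i))) ->
  (forall i, measurable_fun setT (fun s => complex.Im (f s 0 i))) ->
  measurable_fun setT f.
Proof.
move=> fRe fIm; apply: (@measurability _ _ S state_space setT f (@state_cylinders R d)) => //.
move=> _ [_ [i [B [mB [->|->]]]] <-].
  exact: fRe.
exact: fIm.
Qed.

Definition measurable_cfun (f : S -> C) : Prop :=
  measurable_fun setT (fun s => complex.Re (f s)) /\
  measurable_fun setT (fun s => complex.Im (f s)).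

Lemma measurable_cfun_sum (I : Type) (r : seq I) (f : I -> S -> C) :
  (forall i, measurable_cfun (f i)) -> measurable_cfun (fun s => \sum_(i <- r) f i s).
Proof.
move=> mf; split.
  under eq_fun do rewrite raddf_sum /=.
  by apply: measurable_sum => i; case: (mf i).
under eq_fun do rewrite raddf_sum /=.
by apply: measurable_sum => i; case: (mf i).
Qed.

Lemma measurable_cfunM (f g : S -> C) :
  measurable_cfun f -> measurable_cfun g -> measurable_cfun (fun s => f s * g s).
Proof.
move=> [f1 f2] [g1 g2]; split.
  have -> : (fun s => complex.Re (f s * g s)) = fun s =>
      complex.Re (f s) * complex.Re (g s) - complex.Im (f s) * complex.Im (g s).
    by apply/funext => s; case: (f s) (g s) => [a b] [a' b'].
  by apply: measurable_funB; apply: measurable_funM.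
have -> : (fun s => complex.Im (f s * g s)) = fun s =>
    complex.Re (f s) * complex.Im (g s) + complex.Im (f s) * complex.Re (g s).
  by apply/funext => s; case: (f s) (g s) => [a b] [a' b'].
by apply: measurable_funD; apply: measurable_funM.
Qed.

Lemma measurable_cfun_conj (f : S -> C) :
  measurable_cfun f -> measurable_cfun (fun s => (f s)^*).
Proof.
move=> [f1 f2]; split.
  by have -> : (fun s => complex.Re (f s)^*) = fun s => complex.Re (f s);
    first by apply/funext => s; case: (f s).
have -> : (fun s => complex.Im (f s)^*) = fun s => - complex.Im (f s).
  by apply/funext => s; case: (f s).
exact: measurable_funN.
Qed.

Lemma measurable_cfun_cst (c : C) : measurable_cfun (fun=> c).
Proof. by split; exact: measurable_cst. Qed.

Lemma measurable_cfun_coord (f : S -> state_space) i : measurable_fun setT f ->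
  measurable_cfun (fun s => f s 0 i).
Proof.
by move=> mf; split;
  [apply: (measurableT_comp (measurable_fun_Re i))
  |apply: (measurableT_comp (measurable_fun_Im i))].
Qed.

Lemma measurable_overlap (f g : S -> state_space) : measurable_fun setT f ->
  measurable_fun setT g -> measurable_fun setT (fun s => @overlap R d (f s) (g s)).
Proof.
move=> mf mg.
have [m1 _] : measurable_cfun (fun s => dotmx (f s) (g s) * (dotmx (f s) (g s))^*).
  have md : measurable_cfun (fun s => dotmx (f s) (g s)).
    under eq_fun do rewrite dotmx_sum.
    apply: measurable_cfun_sum => i; apply: measurable_cfunM.
      exact: measurable_cfun_coord.
    by apply: measurable_cfun_conj; exact: measurable_cfun_coord.
  by apply: measurable_cfunM => //; exact: measurable_cfun_conj.
by under eq_fun do rewrite -[overlap _ _]/(complex.Re (overlap _ _)%:C) overlapE.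
Qed.

Lemma measurable_mulmx_state (f : S -> state_space) (U : 'M[C]_d) :
  measurable_fun setT f ->
  measurable_fun setT (fun s => (f s : 'rV[C]_d) *m U : state_space).
Proof.
move=> mf.
have mc i : measurable_cfun (fun s => ((f s : 'rV[C]_d) *m U) 0 i).
  under eq_fun do rewrite mxE.
  apply: measurable_cfun_sum => j; apply: measurable_cfunM.
    exact: measurable_cfun_coord.
  exact: measurable_cfun_cst.
by apply: measurable_fun_state => i; case: (mc i).
Qed.

End Maps.
End StateSpace.

(** * Laws, means and powers of quadratic polynomials *)

Section Laws.
Context {disp : measure_display} {T : measurableType disp} {R : realType}.
Variable P : probability T R.

Lemma ge0_integral_eq_law (dS : measure_display) (S : measurableType dS)
    (f g : T -> S) (F : S -> \bar R) :
  measurable_fun setT f -> measurable_fun setT g ->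
  (forall A, measurable A -> P (f @^-1` A) = P (g @^-1` A)) ->
  measurable_fun setT F -> (forall s, (0 <= F s)%E) ->
  (\int[P]_w F (f w) = \int[P]_w F (g w))%E.
Proof.
move=> mf mg fg mF F0.
pose f_mixin := isMeasurableFun.Build _ _ _ _ _ mf.
pose f' : {mfun T >-> S} := HB.pack f f_mixin.
pose g_mixin := isMeasurableFun.Build _ _ _ _ _ mg.
pose g' : {mfun T >-> S} := HB.pack g g_mixin.
rewrite -[LHS](@ge0_integral_distribution _ _ _ _ _ P f' F) //.
rewrite -[RHS](@ge0_integral_distribution _ _ _ _ _ P g' F) //.
by apply: eq_measure_integral => A mA _; exact: fg.
Qed.

(** Independence identifies the joint law with the product of the laws on rectangles, hence
    everywhere; Tonelli then integrates over [f] first, with [g] frozen. *)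
Lemma ge0_integral_independent (d1 d2 : measure_display)
    (S1 : measurableType d1) (S2 : measurableType d2)
    (f : T -> S1) (g : T -> S2) (F : S1 * S2 -> \bar R) :
  measurable_fun setT f -> measurable_fun setT g ->
  (forall A B, measurable A -> measurable B ->
    P (f @^-1` A `&` g @^-1` B) = (P (f @^-1` A) * P (g @^-1` B))%E) ->
  measurable_fun setT F -> (forall s, (0 <= F s)%E) ->
  (\int[P]_w F (f w, g w) = \int[P]_w' \int[P]_w F (f w, g w'))%E.
Proof.
move=> mf mg fg mF F0.
pose f_mixin := isMeasurableFun.Build _ _ _ _ _ mf.
pose f' : {mfun T >-> S1} := HB.pack f f_mixin.
pose g_mixin := isMeasurableFun.Build _ _ _ _ _ mg.
pose g' : {mfun T >-> S2} := HB.pack g g_mixin.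
have mfg : measurable_fun setT (fun w => (f w, g w)).
  exact: measurable_fun_pair.
pose fg_mixin := isMeasurableFun.Build _ _ _ _ _ mfg.
pose fg' : {mfun T >-> (S1 * S2)%type} := HB.pack (fun w => (f w, g w)) fg_mixin.
rewrite -[LHS](@ge0_integral_distribution _ _ _ _ _ P fg' F) //.
transitivity (\int[distribution P f' \x distribution P g']_z F z)%E.
  apply: eq_measure_integral => A mA _; apply/esym.
  apply: product_measure_unique; last exact: mA.
  by move=> B1 B2 mB1 mB2; exact: (fg B1 B2 mB1 mB2).
rewrite fubini_tonelli2 //.
rewrite (@ge0_integral_distribution _ _ _ _ _ P g' (fubini_G (distribution P f') F)).
- apply: eq_integral => w _ /=; rewrite /fubini_G.
  rewrite (@ge0_integral_distribution _ _ _ _ _ P f' (fun x => F (x, g w))) //.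
  exact: measurable_fun_pair1.
- exact: measurable_fun_fubini_tonelli_G.
- by move=> y; apply: integral_ge0.
Qed.

Definition bounded_mfun (f : T -> R) : Prop :=
  measurable_fun setT f /\ exists K, forall w, `|f w| <= K.

Lemma bounded_mfun_integrable f : bounded_mfun f ->
  P.-integrable setT (EFin \o f).
Proof.
move=> [mf [K fK]]; apply: measurable_bounded_integrable => //.
  by rewrite (le_lt_trans (probability_le1 P measurableT)) ?ltry.
exists K; split; first exact: num_real.
by move=> x Kx w _; apply: le_trans (fK w) (ltW Kx).
Qed.

Lemma bounded_mfunD f g : bounded_mfun f -> bounded_mfun g ->
  bounded_mfun (fun w => f w + g w).
Proof.
move=> [mf [K fK]] [mg [L gL]]; split; first exact: measurable_funD.
by exists (K + L) => w; rewrite (le_trans (ler_normD _ _)) // lerD.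
Qed.

Lemma bounded_mfunM f g : bounded_mfun f -> bounded_mfun g ->
  bounded_mfun (fun w => f w * g w).
Proof.
move=> [mf [K fK]] [mg [L gL]]; split; first exact: measurable_funM.
by exists (K * L) => w; rewrite normrM ler_pM.
Qed.

Lemma bounded_mfun_cst c : bounded_mfun (fun=> c).
Proof. by split; [exact: measurable_cst | exists `|c|]. Qed.

Lemma bounded_mfunX f n : bounded_mfun f -> bounded_mfun (fun w => f w ^+ n).
Proof.
move=> bf; elim: n => [|n IH]; first exact: bounded_mfun_cst.
by under eq_fun do rewrite exprS; exact: bounded_mfunM.
Qed.

Lemma bounded_mfun_sum (I : Type) (r : seq I) (f : I -> T -> R) :
  (forall i, bounded_mfun (f i)) -> bounded_mfun (fun w => \sum_(i <- r) f i w).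
Proof.
move=> bf; elim: r => [|i r IH].
  by under eq_fun do rewrite big_nil; exact: bounded_mfun_cst.
by under eq_fun do rewrite big_cons; exact: bounded_mfunD.
Qed.

Definition mean (f : T -> R) : R := \int[P]_w f w.

Lemma meanE f : bounded_mfun f -> (\int[P]_w (f w)%:E = (mean f)%:E)%E.
Proof.
move=> bf; rewrite /mean /Rintegral fineK //.
exact: integrable_fin_num (bounded_mfun_integrable bf).
Qed.

Lemma meanD f g : bounded_mfun f -> bounded_mfun g ->
  mean (fun w => f w + g w) = mean f + mean g.
Proof. by move=> bf bg; apply: RintegralD => //; exact: bounded_mfun_integrable. Qed.

Lemma meanZ c f : bounded_mfun f -> mean (fun w => c * f w) = c * mean f.
Proof. by move=> bf; apply: RintegralZl => //; exact: bounded_mfun_integrable. Qed.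

Lemma mean_cst c : mean (fun=> c) = c.
Proof. by rewrite /mean Rintegral_cst //= probability_setT mulr1. Qed.

Lemma mean_sum (I : Type) (r : seq I) (f : I -> T -> R) :
  (forall i, bounded_mfun (f i)) ->
  mean (fun w => \sum_(i <- r) f i w) = \sum_(i <- r) mean (f i).
Proof.
move=> bf; elim: r => [|i r IH].
  by under eq_fun do rewrite big_nil; rewrite big_nil mean_cst.
under eq_fun do rewrite big_cons.
by rewrite big_cons meanD ?IH //; exact: bounded_mfun_sum.
Qed.

End Laws.

Section QuadraticPower.
Variable R : realType.
Implicit Types A B C : R.

(** Modelled on [|x + t y|^2], where [B] is the real part of [x] times the conjugate of [y]. *)
Definition quadratic A B C : {poly R} := A%:P + (2 * B) *: 'X + C *: 'X^2.

Lemma horner_quadratic A B C t :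
  (quadratic A B C).[t] = A + 2 * t * B + t ^+ 2 * C.
Proof. by rewrite /quadratic !(hornerD, hornerZ, hornerC, hornerX, hornerXn); ring. Qed.

Lemma size_quadratic_exp A B C n : (size (quadratic A B C ^+ n) <= n.*2.+1)%N.
Proof.
have s3 : (size (quadratic A B C) <= 3)%N.
  have sA : (size A%:P <= 3)%N by exact: leq_trans (size_polyC_leq1 A) _.
  have sB : (size ((2 * B) *: 'X : {poly R}) <= 3)%N.
    by rewrite (leq_trans (size_scale_leq _ _)) ?size_polyX.
  have sC : (size (C *: 'X^2 : {poly R}) <= 3)%N.
    by rewrite (leq_trans (size_scale_leq _ _)) ?size_polyXn.
  rewrite /quadratic (leq_trans (size_polyD _ _)) // geq_max sC andbT.
  by rewrite (leq_trans (size_polyD _ _)) // geq_max sA.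
apply: leq_trans (size_poly_exp_leq _ _) _; rewrite ltnS -muln2 mulnC.
rewrite leq_mul2l; case: (size _) s3 => [|m] /=; first by rewrite orbT.
by rewrite ltnS => ->; rewrite orbT.
Qed.

Lemma coef_quadratic_mul A B C (p : {poly R}) i :
  (quadratic A B C * p)`_i = A * p`_i
   + (if i is j.+1 then 2 * B * p`_j else 0)
   + (if i is j.+2 then C * p`_j else 0).
Proof.
rewrite /quadratic !mulrDl -!scalerAl !coefD coefCM !coefZ coefXM coefXnM.
by case: i => [|[|i]] //=; rewrite ?mulr0 // subn2.
Qed.

Lemma coef_quadratic_exp A B C n : let p := quadratic A B C ^+ n in
  [/\ p`_0 = A ^+ n, p`_1 = n%:R * A ^+ n.-1 * (2 * B) &
      p`_2 = n%:R * A ^+ n.-1 * C + 2 * (n%:R * n.-1%:R) * A ^+ n.-2 * B ^+ 2].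
Proof.
elim: n => [|n [IH0 IH1 IH2]] /=.
  by rewrite expr0 -polyC1 !coefC /= !mul0r mulr0 !mul0r addr0.
rewrite exprS !coef_quadratic_mul IH0 IH1 IH2; split.
- by rewrite !addr0 -exprS.
- rewrite addr0 -[n.+1%:R]natr1; case: n {IH0 IH1 IH2} => [|n] /=.
    by rewrite !expr0; ring.
  by rewrite exprS; ring.
- rewrite -[n.+1%:R]natr1; case: n {IH0 IH1 IH2} => [|[|n]] /=.
  + by rewrite !expr0; ring.
  + by rewrite !expr0 !expr1; ring.
  + by rewrite -[n.+2%:R]natr1 !exprS; ring.
Qed.

(** The hypothesis trades the squared cross terms for [A * C]; the weights [2 (k + 1)] and
    [2 (k + 1) k] then add up to [2 (k + 1) ^ 2]. *)
Lemma coef2_quadratic_pair A B B' C k : B ^+ 2 + B' ^+ 2 = A * C ->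
  (quadratic A B C ^+ k.+1 + quadratic A B' C ^+ k.+1)`_2 =
  (2 * k.+1%:R ^+ 2) * (A ^+ k * C).
Proof.
move=> abc; rewrite coefD; have [_ _ ->] := coef_quadratic_exp A B C k.+1.
have [_ _ ->] := coef_quadratic_exp A B' C k.+1 => /=.
transitivity (2 * (k.+1%:R * A ^+ k * C)
  + 2 * (k.+1%:R * k%:R) * A ^+ k.-1 * (B ^+ 2 + B' ^+ 2)); first by ring.
rewrite abc -[k.+1%:R]natr1; case: k => [|k] /=; first by rewrite expr0; ring.
by rewrite exprS; ring.
Qed.

Lemma bounded_mfun_coef_quadratic_exp (disp : measure_display)
    (T : measurableType disp) (a b c : T -> R) n i :
  bounded_mfun a -> bounded_mfun b -> bounded_mfun c ->
  bounded_mfun (fun w => (quadratic (a w) (b w) (c w) ^+ n)`_i).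
Proof.
move=> ba bb bc; elim: n i => [|n IH] i.
  by under eq_fun do rewrite expr0; exact: bounded_mfun_cst.
under eq_fun do rewrite exprS coef_quadratic_mul.
apply: bounded_mfunD; first apply: bounded_mfunD.
- exact: bounded_mfunM.
- case: i => [|i]; first exact: bounded_mfun_cst.
  apply: bounded_mfunM => //; apply: bounded_mfunM => //; exact: bounded_mfun_cst.
- case: i => [|[|i]]; try exact: bounded_mfun_cst.
  exact: bounded_mfunM.
Qed.

End QuadraticPower.

(** * Cauchy-Schwarz, Parseval and polarization for overlaps *)

Section OverlapLemmas.
Variables (R : realType) (d : nat).
Local Notation C := R[i].
Local Notation e_ i := (delta_mx 0 i : 'rV[C]_d).
Implicit Types (u v : 'rV[C]_d).

Lemma overlap_sqr u v :
  overlap u v = complex.Re (dotmx u v) ^+ 2 + complex.Im (dotmx u v) ^+ 2.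
Proof.
rewrite -[LHS]/(complex.Re (overlap u v)%:C) overlapE.
by case: (dotmx u v) => a b /=; rewrite mulrN opprK !expr2.
Qed.

Lemma overlap_ge0 u v : 0 <= overlap u v.
Proof. by rewrite overlap_sqr addr_ge0 ?sqr_ge0. Qed.

Lemma overlap_le u v : unit_state u -> overlap u v <= complex.Re (dotmx v v).
Proof.
move=> uu; have : `|dotmx u v| ^+ 2 <= dotmx u u * dotmx v v.
  by case: (CauchySchwarz (@dotmx C d) u v).
by rewrite uu mul1r lecE => /andP[].
Qed.

Lemma overlap_coord u i : overlap u (e_ i) = complex.Re (u 0 i * (u 0 i)^*).
Proof.
rewrite -[LHS]/(complex.Re (overlap _ _)%:C) overlapE dotmx_sum (bigD1 i) //=.
rewrite big1 => [|j /negPf ji]; last by rewrite !mxE ji andbF conjC0 mulr0.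
by rewrite mxE !eqxx conjC1 mulr1 addr0.
Qed.

Lemma sum_overlap_coord u : unit_state u -> \sum_i overlap u (e_ i) = 1.
Proof.
move=> uu; under eq_bigr do rewrite overlap_coord.
by rewrite -raddf_sum /= -dotmx_sum uu.
Qed.

Lemma overlapZr u v (c : C) : overlap u (c *: v) = complex.Re (c * c^*) * overlap u v.
Proof.
have dZ : dotmx u (c *: v) = c^* * dotmx u v.
  by rewrite dotmxC dotmxZl rmorphM /= -dotmxC.
apply: (fmorph_inj (real_complex R)); rewrite rmorphM /= !overlapE dZ.
rewrite RRe_real; last by rewrite -normCK ger0_real // exprn_ge0.
by rewrite rmorphM /= conjCK mulrACA (mulrC c).
Qed.

Lemma overlap_two_coords u o i (z : C) : o != i ->
  overlap u (e_ o + z *: e_ i) =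
  complex.Re ((u 0 o + z^* * u 0 i) * (u 0 o + z^* * u 0 i)^*).
Proof.
move=> oi; rewrite -[LHS]/(complex.Re (overlap _ _)%:C) overlapE.
suff -> : dotmx u (e_ o + z *: e_ i) = u 0 o + z^* * u 0 i by [].
rewrite dotmx_sum (bigD1 o) //= (bigD1 i) 1?eq_sym //= big1 => [|j /andP[jo ji]].
  rewrite !mxE !eqxx (negPf oi) eq_sym (negPf oi) /= !mulr0 addr0 add0r mulr1 conjC1.
  by rewrite mulr1 addr0 mulrC.
by rewrite !mxE (negPf jo) (negPf ji) /= mulr0 addr0 conjC0 mulr0.
Qed.

Lemma norm_two_coords o i (z : C) : o != i ->
  dotmx (e_ o + z *: e_ i) (e_ o + z *: e_ i) = 1 + z * z^*.
Proof.
move=> oi; rewrite dotmx_sum (bigD1 o) //= (bigD1 i) 1?eq_sym //= big1 => [|j /andP[jo ji]].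
  rewrite !mxE !eqxx (negPf oi) eq_sym (negPf oi) /= !mulr0 addr0 add0r mulr1 conjC1.
  by rewrite mulr1 addr0.
by rewrite !mxE (negPf jo) (negPf ji) /= mulr0 addr0 conjC0 mulr0.
Qed.

(* The cross terms of |x + t y|^2 and |x + i t y|^2 are 2 t Re (x conj y) and
   2 t Im (x conj y), whose squares add up to 4 t^2 |x|^2 |y|^2. *)
Lemma overlap_quadratic u o i : o != i -> exists2 b : R * R,
  b.1 = (overlap u (e_ o + 1 *: e_ i) - overlap u (e_ o) - overlap u (e_ i)) / 2 /\
  b.2 = (overlap u (e_ o + (- 'i) *: e_ i) - overlap u (e_ o) - overlap u (e_ i)) / 2 &
  [/\ b.1 ^+ 2 + b.2 ^+ 2 = overlap u (e_ o) * overlap u (e_ i),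
   forall t : R, overlap u (e_ o + t%:C *: e_ i) =
     overlap u (e_ o) + 2 * t * b.1 + t ^+ 2 * overlap u (e_ i) &
   forall t : R, overlap u (e_ o + (t%:C * - 'i) *: e_ i) =
     overlap u (e_ o) + 2 * t * b.2 + t ^+ 2 * overlap u (e_ i)].
Proof.
move=> oi; exists ((overlap u (e_ o + 1 *: e_ i) - overlap u (e_ o) - overlap u (e_ i)) / 2,
  (overlap u (e_ o + (- 'i) *: e_ i) - overlap u (e_ o) - overlap u (e_ i)) / 2) => //=.
have eqi : ('i : C) = 0 +i* 1 by [].
have cj (z : C) : z^* = complex.Re z -i* complex.Im z by case: z.
rewrite !overlap_coord !overlap_two_coords // !cj.
split=> [|t|t]; rewrite ?overlap_two_coords // ?cj;
  by case: (u 0 o) (u 0 i) => x1 x2 [y1 y2]; simpc => /=; field.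
Qed.

End OverlapLemmas.

(** * Moments of the overlap of Haar-random states *)

(** Gram-Schmidt is applied to the matrix all of whose rows are [y]: as [o] is the least index, row
    [o] of the result is [y] up to a phase. *)
Lemma ex_unitary_row (C : numClosedFieldType) d (y : 'rV[C]_d) (o : 'I_d) :
  (forall k : 'I_d, (k <= o)%N = (k == o)) -> dotmx y y = 1 ->
  exists (U : 'M[C]_d) (c : C), [/\ U \is unitarymx, y = c *: row o U & c * c^* = 1].
Proof.
move=> omin yy; pose A : 'M[C]_d := \matrix_(i, j) y 0 j.
have rA : row o A = y by apply/rowP => j; rewrite !mxE.
have uB : schmidt A \is unitarymx by exact: schmidt_unitarymx.
have := row_schmidt_sub A o; rewrite rA (eq_bigl (pred1 o)) // big_pred1_eq genmxE.
move=> /sub_rVP[c yc]; exists (schmidt A), c; split => //.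
have /row_unitarymxP /(_ o o) := uB; rewrite eqxx => Boo.
move: yy; rewrite yc dotmxE -scalemxAl linearZ /= map_mxZ -scalemxAr scalerA mxE.
by rewrite -dotmxE Boo mulr1.
Qed.

Lemma dotmx_mulmx_adj (C : numClosedFieldType) m n (u : 'rV[C]_n) (v : 'rV[C]_m)
    (U : 'M[C]_(m, n)) :
  dotmx u (v *m U) = dotmx (u *m U^t*) v.
Proof. by rewrite !dotmxE trmx_mul map_mxM mulmxA. Qed.

Opaque overlap.

Section HaarMoments.
Variables (R : realType) (d : nat) (hd : (2 <= d)%N).
Local Notation C := R[i].
Local Notation e_ i := (delta_mx 0 i : 'rV[C]_d).
Variables (disp : measure_display) (T : measurableType disp) (P : probability T R).

Implicit Types (psi phi : T -> 'rV[C]_d) (v y : 'rV[C]_d).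

Let o : 'I_d := Ordinal (ltnW hd).

Lemma measurable_haar_state psi : haar_random_state P psi ->
  measurable_fun setT (psi : T -> state_space R d).
Proof. by case=> mpsi _ _ _ A mA; rewrite setTI; exact: mpsi. Qed.

Lemma bounded_overlap psi v : haar_random_state P psi ->
  bounded_mfun (fun w => overlap (psi w) v).
Proof.
move=> hpsi; split.
  by apply: measurable_overlap; [exact: measurable_haar_state | exact: measurable_cst].
have [_ upsi _] := hpsi.
exists (complex.Re (dotmx v v)) => w; rewrite ger0_norm ?overlap_ge0 //.
exact: overlap_le.
Qed.

Lemma bounded_overlap2 psi phi : haar_random_state P psi -> haar_random_state P phi ->
  bounded_mfun (fun w => overlap (psi w) (phi w)).
Proof.
move=> hpsi hphi; split.
  by apply: measurable_overlap; exact: measurable_haar_state.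
have [_ upsi _] := hpsi; have [_ uphi _] := hphi.
exists 1 => w; rewrite ger0_norm ?overlap_ge0 //.
by rewrite (le_trans (overlap_le _ (upsi w))) // (uphi w).
Qed.

Definition haar_moment (psi : T -> 'rV[C]_d) (k : nat) : R :=
  mean P (fun w => overlap (psi w) (e_ o) ^+ k).

(** A unitary takes [y] to a phase times [e_o], and the law of [psi] is invariant. *)
Lemma mean_overlap_unit psi y k : haar_random_state P psi -> unit_state y ->
  mean P (fun w => overlap (psi w) y ^+ k) = haar_moment psi k.
Proof.
move=> hpsi uy; have mpsi := measurable_haar_state hpsi.
have omin (l : 'I_d) : (l <= o)%N = (l == o) by rewrite leqn0 -val_eqE.
have [U [c [uU yU cc]]] := ex_unitary_row omin uy.
have [_ _ inv] := hpsi.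
have uUt : U^t* \is unitarymx by rewrite trmxC_unitary.
have ovE w : overlap (psi w) y = overlap (psi w *m U^t*) (e_ o).
  by rewrite yU overlapZr cc mul1r !overlap_sqr rowE dotmx_mulmx_adj.
rewrite /haar_moment /mean /Rintegral; apply: (congr1 fine).
transitivity (\int[P]_w (overlap (psi w *m U^t* ) (e_ o) ^+ k)%:E)%E.
  by apply: eq_integral => w _; apply: (congr1 (fun z => (z ^+ k)%:E) (ovE w)).
apply: (@ge0_integral_eq_law _ _ _ P _ (state_space R d)
  (fun w => psi w *m U^t* : state_space R d) psi
  (fun v => (@overlap R d v (e_ o) ^+ k)%:E)) => //.
- exact: (@measurable_mulmx_state R d _ T psi).
- by move=> A mA; exact: (inv _ uUt A mA).
- apply/measurable_EFinP; apply: measurable_funX.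
  by apply: measurable_overlap; [exact: measurable_id | exact: measurable_cst].
- by move=> v; rewrite lee_fin exprn_ge0 // overlap_ge0.
Qed.

Lemma mean_overlap_scaled psi v s k : haar_random_state P psi -> 0 < s ->
  dotmx v v = s%:C ->
  mean P (fun w => overlap (psi w) v ^+ k) = s ^+ k * haar_moment psi k.
Proof.
move=> hpsi s0 vs; pose y := ((Num.sqrt s)^-1)%:C *: v.
have ss : Num.sqrt s * Num.sqrt s = s by rewrite -expr2 sqr_sqrtr // ltW.
have ns : Num.sqrt s != 0 by rewrite gt_eqF // sqrtr_gt0.
have uy : unit_state y.
  rewrite /unit_state /y dotmxZl dotmxC dotmxZl rmorphM /= conj_real_complex.
  rewrite -dotmxC vs -!rmorphM /= mulrA -invfM ss mulVf ?gt_eqF //.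
have vy : v = (Num.sqrt s)%:C *: y.
  by rewrite /y scalerA -rmorphM mulfV // rmorph1 scale1r.
rewrite -(mean_overlap_unit k hpsi uy) -meanZ; last first.
  by apply: bounded_mfunX; exact: bounded_overlap.
apply: (congr1 (mean P)); apply/funext => w; rewrite vy overlapZr conj_real_complex -rmorphM /=.
by rewrite ss exprMn.
Qed.

(** The moment of order [k + 1] at [e_o + t z e_i] is [(1 + t ^ 2) ^ (k + 1)] times that at [e_o].
    Adding the cases [z = 1] and [z = -i] and comparing coefficients of [t ^ 2] leaves a single
    mixed moment. *)
Lemma haar_moment_coord psi k i : haar_random_state P psi -> o != i ->
  k.+1%:R * mean P (fun w => overlap (psi w) (e_ o) ^+ k * overlap (psi w) (e_ i)) =
  haar_moment psi k.+1.
Proof.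
move=> hpsi oi.
pose a w := overlap (psi w) (e_ o); pose c w := overlap (psi w) (e_ i).
(* Written through overlaps, the cross terms inherit measurability and boundedness. *)
pose b w := (overlap (psi w) (e_ o + 1 *: e_ i) - a w - c w) / 2.
pose b' w := (overlap (psi w) (e_ o + (- 'i) *: e_ i) - a w - c w) / 2.
have bB f g h : bounded_mfun f -> bounded_mfun g -> bounded_mfun h ->
    @bounded_mfun _ T R (fun w => (f w - g w - h w) / 2).
  move=> bf bg bh; apply: bounded_mfunM; last exact: bounded_mfun_cst.
  have bN g' : bounded_mfun g' -> @bounded_mfun _ T R (fun w => - g' w).
    by move=> bg'; under eq_fun do rewrite -mulN1r; apply: bounded_mfunM => //;
       exact: bounded_mfun_cst.
  by apply: bounded_mfunD; [apply: bounded_mfunD => //|]; exact: bN.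
have ba : bounded_mfun a by exact: bounded_overlap.
have bc : bounded_mfun c by exact: bounded_overlap.
have bb : bounded_mfun b := bB _ a c (bounded_overlap _ hpsi) ba bc.
have bb' : bounded_mfun b' := bB _ a c (bounded_overlap _ hpsi) ba bc.
have quad w : [/\ b w ^+ 2 + b' w ^+ 2 = a w * c w,
    forall t : R, overlap (psi w) (e_ o + t%:C *: e_ i) = (quadratic (a w) (b w) (c w)).[t] &
    forall t : R, overlap (psi w) (e_ o + (t%:C * - 'i) *: e_ i) =
      (quadratic (a w) (b' w) (c w)).[t]].
  have [[x y] /= [xE yE] [h1 h2 h3]] := overlap_quadratic (psi w) oi.
  have -> : b w = x by exact: esym xE.
  have -> : b' w = y by exact: esym yE.
  split; first exact: h1.
    by move=> t; rewrite horner_quadratic; exact: h2.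
  by move=> t; rewrite horner_quadratic; exact: h3.
pose n := k.+1.
pose p w := quadratic (a w) (b w) (c w) ^+ n + quadratic (a w) (b' w) (c w) ^+ n.
have bp j : bounded_mfun (fun w => (p w)`_j).
  under eq_fun do rewrite coefD.
  exact: (bounded_mfunD (bounded_mfun_coef_quadratic_exp n j ba bb bc)
    (bounded_mfun_coef_quadratic_exp n j ba bb' bc)).
have sp w : (size (p w) <= n.*2.+1)%N.
  apply: leq_trans (size_polyD _ _) _; rewrite geq_max.
  by apply/andP; split; exact: size_quadratic_exp.
have pt t : mean P (fun w => (p w).[t]) = 2 * haar_moment psi n * (1 + t ^+ 2) ^+ n.
  have t0 : 0 < 1 + t ^+ 2 by rewrite ltr_wpDr ?sqr_ge0.
  have n1 : dotmx (e_ o + t%:C *: e_ i) (e_ o + t%:C *: e_ i) = (1 + t ^+ 2)%:C.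
    by rewrite norm_two_coords // conj_real_complex -rmorphM -expr2 rmorphD rmorph1.
  have n2 : dotmx (e_ o + (t%:C * - 'i) *: e_ i) (e_ o + (t%:C * - 'i) *: e_ i) =
      (1 + t ^+ 2)%:C.
    rewrite norm_two_coords // rmorphM /= conj_real_complex rmorphN /= conjCi opprK.
    by rewrite mulrACA mulNr -expr2 sqrCi opprK mulr1 -rmorphM -expr2 rmorphD rmorph1.
  transitivity (mean P (fun w => overlap (psi w) (e_ o + t%:C *: e_ i) ^+ n +
      overlap (psi w) (e_ o + (t%:C * - 'i) *: e_ i) ^+ n)).
    apply: (congr1 (mean P)); apply/funext => w; have [_ h2 h3] := quad w.
    have hp (q r : {poly R}) : (q ^+ n + r ^+ n).[t] = q.[t] ^+ n + r.[t] ^+ n.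
      by rewrite hornerD !horner_exp.
    apply: eq_trans (hp _ _) _.
    exact: (congr2 (fun x y : R => x ^+ n + y ^+ n) (esym (h2 t)) (esym (h3 t))).
  rewrite (meanD P (bounded_mfunX n (bounded_overlap (e_ o + t%:C *: e_ i) hpsi))
    (bounded_mfunX n (bounded_overlap (e_ o + (t%:C * - 'i) *: e_ i) hpsi))).
  apply: (eq_trans (congr2 (fun x y : R => x + y)
    (mean_overlap_scaled n hpsi t0 n1) (mean_overlap_scaled n hpsi t0 n2))).
  by move: (haar_moment psi n) => m; ring.
(* Averaging coefficient by coefficient turns the pointwise identity [pt] into one of polynomials in
   [t]. *)
have rE : \poly_(j < n.*2.+1) mean P (fun w => (p w)`_j) =
    (2 * haar_moment psi n) *: quadratic 1 0 1 ^+ n.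
  apply: poly_eq_unit_itv => t _; rewrite hornerZ horner_exp horner_quadratic.
  rewrite mulr0 addr0 mulr1 -pt horner_poly.
  under [in RHS]eq_fun do rewrite (horner_coef_wide _ (sp _)).
  rewrite mean_sum.
    apply: eq_bigr => j _; rewrite mulrC -meanZ //.
    by apply: (congr1 (mean P)); apply/funext => w; rewrite mulrC.
  by move=> j; apply: bounded_mfunM => //; exact: bounded_mfun_cst.
(* At [t ^ 2] the left side is the mean of [2 n^2 a^k c], the right side [2 n] times the moment of
   order [n]. *)
have := congr1 (fun q : {poly R} => q`_2) rE; rewrite coef_poly coefZ /=.
have [_ _ ->] := coef_quadratic_exp (1 : R) 0 1 n.
rewrite !expr1n expr0n /= mulr0 addr0 !mulr1 => p2.
have pE w : (p w)`_2 = (2 * n%:R ^+ 2) * (a w ^+ k * c w).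
  by have [abc _ _] := quad w; exact: coef2_quadratic_pair.
move: p2; under eq_fun do rewrite pE.
rewrite meanZ => [|]; last by apply: bounded_mfunM => //; exact: bounded_mfunX.
have n0 : n%:R != 0 :> R by rewrite pnatr_eq0.
move=> e; rewrite -[LHS]/(n%:R * mean P (fun w => a w ^+ k * c w)).
have nz : 2 * n%:R != 0 :> R by rewrite mulf_neq0 // pnatr_eq0.
move: (mean P _) (haar_moment psi n) e => E m e; apply: (mulfI nz).
transitivity (2 * n%:R ^+ 2 * E); first by ring.
by rewrite e; ring.
Qed.

(** The overlaps with the basis vectors sum to 1. Inserting this sum, [o] contributes the moment of
    order [k + 1] and each of the [d - 1] other directions that moment divided by [k + 1]. *)
Lemma haar_moment_rec psi k : haar_random_state P psi ->
  k.+1%:R * haar_moment psi k = (k + d)%:R * haar_moment psi k.+1.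
Proof.
move=> hpsi; have [_ upsi _] := hpsi.
have mE : haar_moment psi k = \sum_i
    mean P (fun w => overlap (psi w) (e_ o) ^+ k * overlap (psi w) (e_ i)).
  rewrite -mean_sum; last first.
    by move=> i; apply: bounded_mfunM; [apply: bounded_mfunX|]; exact: bounded_overlap.
  apply: (congr1 (mean P)); apply/funext => w.
  by rewrite -mulr_sumr sum_overlap_coord ?mulr1 //; exact: upsi.
rewrite {1}mE (bigD1 o) //= mulrDr mulr_sumr.
rewrite (eq_bigr (fun=> haar_moment psi k.+1)) => [|i io]; last first.
  by apply: haar_moment_coord; rewrite // eq_sym.
rewrite sumr_const cardC1 card_ord.
have -> : mean P (fun w => overlap (psi w) (e_ o) ^+ k * overlap (psi w) (e_ o)) =
    haar_moment psi k.+1.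
  by apply: (congr1 (mean P)); apply/funext => w; rewrite exprSr.
by rewrite !mulr_natl -mulrnDr addSn -addnS prednK ?(ltnW hd).
Qed.

(** Both sequences start at 1 and obey the same recursion. *)
Lemma haar_momentE psi k : haar_random_state P psi ->
  haar_moment psi k = overlap_mean d ('X^k : {poly R}).
Proof.
move=> hpsi; elim: k => [|k IH].
  rewrite expr0 (overlap_mean1 R hd) /haar_moment.
  by under eq_fun do rewrite expr0; rewrite mean_cst.
have nz : (k + d)%:R != 0 :> R by rewrite pnatr_eq0 addn_eq0 negb_and -(lt0n d) (ltnW hd) orbT.
by apply: (mulfI nz); rewrite -haar_moment_rec // IH overlap_mean_recl.
Qed.

(** With [phi] frozen, the mean over [psi] is the Haar moment, whatever unit vector [phi] is. *)
Lemma mean_overlap_haar psi phi k : haar_random_state P psi ->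
  haar_random_state P phi -> independent_states P psi phi ->
  mean P (fun w => overlap (psi w) (phi w) ^+ k) = overlap_mean d ('X^k : {poly R}).
Proof.
move=> hpsi hphi ind; have [_ uphi _] := hphi.
apply: EFin_inj; rewrite -[LHS]meanE; last first.
  by apply: bounded_mfunX; exact: bounded_overlap2.
rewrite (@ge0_integral_independent _ _ _ P _ _ (state_space R d) (state_space R d)
  psi phi (fun z => (@overlap R d z.1 z.2 ^+ k)%:E)).
- transitivity (\int[P]__ (haar_moment psi k)%:E)%E.
    apply: eq_integral => w _ /=; rewrite -(mean_overlap_unit k hpsi (uphi w)) meanE //.
    by apply: bounded_mfunX; exact: bounded_overlap.
  by rewrite meanE ?mean_cst ?haar_momentE //; exact: bounded_mfun_cst.
- exact: measurable_haar_state.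
- exact: measurable_haar_state.
- by move=> A B mA mB; exact: ind.
- apply/measurable_EFinP; apply: measurable_funX.
  by apply: measurable_overlap; [exact: measurable_fst | exact: measurable_snd].
- by move=> z; rewrite lee_fin exprn_ge0 // overlap_ge0.
Qed.

Lemma mean_horner_overlap psi phi (q : {poly R}) : haar_random_state P psi ->
  haar_random_state P phi -> independent_states P psi phi ->
  (\int[P]_w (q.[overlap (psi w) (phi w)])%:E = (overlap_mean d q)%:E)%E.
Proof.
move=> hpsi hphi ind; have bo := bounded_overlap2 hpsi hphi.
have bX k : bounded_mfun (fun w => overlap (psi w) (phi w) ^+ k) by exact: bounded_mfunX.
have bq k : bounded_mfun (fun w => q`_k * overlap (psi w) (phi w) ^+ k).
  by apply: bounded_mfunM => //; exact: bounded_mfun_cst.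
under eq_integral do rewrite horner_coef.
rewrite meanE; last by apply: bounded_mfun_sum => i; exact: bq.
rewrite mean_sum; last by move=> i; exact: bq.
congr (_%:E); rewrite -[in RHS](coefK q) poly_def raddf_sum; apply: eq_bigr => i _.
by rewrite meanZ // mean_overlap_haar // [RHS]linearZ.
Qed.

End HaarMoments.

Transparent overlap.

(** * The posterior mean *)

Section PosteriorMean.
Variables (R : realType) (d N M : nat).
Hypotheses (hd : (2 <= d)%N) (hNM : (N <= M)%N).
Local Notation C := R[i].

Definition outcome_poly_spec (j : nat) (g : {poly R}) : Prop :=
  forall psi phi : 'rV[C]_d, unit_state psi -> unit_state phi ->
    outcome_prob N M j psi phi = g.[overlap psi phi].

Definition posterior_closed_form (j : nat) : R :=
  let J := spin R N M j in
  (d%:R + J + J ^+ 2 + (M%:R + N%:R) / 2 - ((M%:R + N%:R) / 2) ^+ 2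
   + M%:R * N%:R) / ((d%:R + M%:R) * (d%:R + N%:R)).

Lemma cond_prob_poly j g (psi phi : 'rV[C]_d) : outcome_poly_spec j g ->
  unit_state psi -> unit_state phi ->
  cond_prob d N M j (overlap psi phi) = g.[overlap psi phi].
Proof.
move=> gE upsi uphi; rewrite /cond_prob.
set S := (X in xget 0 X).
have : S (xget 0 S) by apply: xgetPex; exists (outcome_prob N M j psi phi), psi, phi.
by case=> psi' [phi' [upsi' uphi' <- <-]]; exact: gE.
Qed.

Lemma cond_prob_itv j g c : outcome_poly_spec j g -> 0 <= c <= 1 ->
  cond_prob d N M j c = g.[c].
Proof.
move=> gE c01; have [psi [phi [upsi uphi <-]]] := ex_overlap_states hd c01.
exact: cond_prob_poly.
Qed.

Lemma posterior_mean_poly j g : outcome_poly_spec j g ->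
  posterior_mean R d N M j = overlap_mean d ('X * g) / overlap_mean d g.
Proof.
move=> gE; rewrite /posterior_mean /overlap_mean /poly_integral.
congr (_ / _); apply: eq_Rintegral => c; rewrite inE /= in_itv /= => c01.
  rewrite (cond_prob_itv gE c01) !hornerM hornerX horner_density_poly.
  by rewrite mulrA (mulrC c).
by rewrite (cond_prob_itv gE c01) hornerM horner_density_poly.
Qed.

Lemma ex_outcome_poly j : (j <= N)%N -> exists g, [/\ outcome_poly_spec j g,
  0 < overlap_mean d g & overlap_mean d ('X * g) = posterior_closed_form j * overlap_mean d g].
Proof.
move=> jN; have [x /=] := outcome_polynomial R hd hNM jN.
set g := \sum_s _ => -[gE gZ g0]; exists g; split => //.
  apply: overlap_mean_gt0 => // c c01.
  have [psi [phi [upsi uphi <-]]] := ex_overlap_states hd c01.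
  by rewrite -gE //; exact: outcome_prob_ge0.
have := casimir_moments hNM (overlap_mean_recl R hd) (erefl g) gZ; rewrite /=.
move: (overlap_mean d g) (overlap_mean d ('X * g)) => A B.
have nz : (d%:R + M%:R) * (d%:R + N%:R) != 0 :> R.
  by rewrite mulf_neq0 // gt_eqF // ltr_wpDr // ltr0n ltnW.
rewrite /posterior_closed_form /spin !natrD !natrB // => e.
apply: (mulfI (mulf_neq0 (_ : 2 != 0 :> R) nz)); first by rewrite pnatr_eq0.
move: e; rewrite !natrX natrD natrB // => e.
(* The Casimir relation is solved for the mean of ['X * g]: the eigenvalue minus the coefficient of
   the mean of [g] is twice the numerator of the closed form. *)
transitivity ((((M%:R + j%:R) ^+ 2 + (N%:R - j%:R) ^+ 2 - (N%:R - j%:R) *+ 2)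
  - ((N%:R + M%:R) ^+ 2 - 2 * N%:R * M%:R - 2 * (N%:R + M%:R) - 2 * d%:R)) * A).
  by rewrite mulrBl e; ring.
field.
by move: nz; rewrite mulf_eq0 negb_or => /andP[-> ->].
Qed.

Lemma global_mse_poly (disp : measure_display) (T : measurableType disp)
    (P : probability T R) (psi phi : T -> 'rV[C]_d) (g : 'I_N.+1 -> {poly R})
    (est : 'I_N.+1 -> R) :
  haar_random_state P psi -> haar_random_state P phi ->
  independent_states P psi phi -> (forall j : 'I_N.+1, outcome_poly_spec j (g j)) ->
  global_mse P M psi phi est =
  (\sum_j overlap_mean d (g j * ((est j)%:P - 'X) ^+ 2))%:E.
Proof.
move=> hpsi hphi ind gE; have [_ upsi _] := hpsi; have [_ uphi _] := hphi.
rewrite -raddf_sum -(mean_horner_overlap hd _ hpsi hphi ind) /global_mse.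
rewrite unlock; apply: eq_integral => w _; congr (_%:E).
rewrite horner_sum; apply: eq_bigr => j _.
by rewrite (gE j) // hornerM horner_exp hornerD hornerN hornerC hornerX.
Qed.

(** Bias-variance decomposition for the weight [g]: the cross term vanishes because [b] is the
    [g]-weighted mean. *)
Lemma overlap_mean_sqr_dev (g : {poly R}) (a b : R) : overlap_mean d g != 0 ->
  overlap_mean d ('X * g) = b * overlap_mean d g ->
  overlap_mean d (g * (a%:P - 'X) ^+ 2) =
  overlap_mean d (g * (b%:P - 'X) ^+ 2) + overlap_mean d g * (a - b) ^+ 2.
Proof.
move=> g0 gb.
have LZ c (p : {poly R}) : overlap_mean d (c *: p) = c * overlap_mean d p.
  exact: linearZ.
have -> : g * (a%:P - 'X) ^+ 2 = g * (b%:P - 'X) ^+ 2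
    + ((a ^+ 2 - b ^+ 2) *: g + (2 * (b - a)) *: ('X * g)).
  by rewrite -!mul_polyC !(polyCB, polyCM, polyCD, rmorphXn) /=; ring.
rewrite !(linearD (@overlap_mean R d)) /= !LZ gb; ring.
Qed.

End PosteriorMean.

Theorem mainTheorem6 (R : realType) (d N M : nat)
    (hd : (2 <= d)%N) (hN : (1 <= N)%N) (hNM : (N <= M)%N) :
  (* <Psi| Pi_J |Psi> depends on the states through their overlap only *)
  (forall (j : 'I_N.+1) (psi phi : 'rV[R[i]]_d),
     unit_state psi -> unit_state phi ->
     outcome_prob N M j psi phi = cond_prob d N M j (overlap psi phi)) /\
  (* for independent Haar-random states, the estimator minimizing the global
     mean square error is the posterior mean *)
  (forall (disp : measure_display) (T : measurableType disp)
      (P : probability T R) (psi phi : T -> 'rV[R[i]]_d),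
     haar_random_state P psi -> haar_random_state P phi ->
     independent_states P psi phi ->
     forall est : 'I_N.+1 -> R,
       minimizes_mse P M psi phi est <->
       (forall j : 'I_N.+1, est j = posterior_mean R d N M j)) /\
  (* closed form of the posterior mean *)
  (forall j : 'I_N.+1,
     let J := spin R N M j in
     posterior_mean R d N M j =
       (d%:R + J + J ^+ 2 + (M%:R + N%:R) / 2 - ((M%:R + N%:R) / 2) ^+ 2
        + M%:R * N%:R)
       / ((d%:R + M%:R) * (d%:R + N%:R))).
Proof.
have /choice[g gP] (j : 'I_N.+1) := @ex_outcome_poly R d N M hd hNM j (ltn_ord j).
have gE (j : 'I_N.+1) : outcome_poly_spec d N M j (g j) by case: (gP j).
have postE (j : 'I_N.+1) : posterior_mean R d N M j = posterior_closed_form R d N M j.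
  have [_ g0 gb] := gP j.
  by rewrite (posterior_mean_poly hd (gE j)) gb mulfK // gt_eqF.
split; [|split] => [j psi phi upsi uphi|disp T P psi phi hpsi hphi ind est|j].
- by rewrite (cond_prob_poly (gE j)) //; exact: gE.
(* The error splits into a part independent of the estimator and a positive combination of squared
   deviations from the closed form. *)
- have dev (e : 'I_N.+1 -> R) : global_mse P M psi phi e =
      (\sum_j overlap_mean d (g j * ((posterior_closed_form R d N M j)%:P - 'X) ^+ 2)
       + \sum_j overlap_mean d (g j) * (e j - posterior_closed_form R d N M j) ^+ 2)%:E.
    rewrite (global_mse_poly hd e hpsi hphi ind gE) -big_split; congr (_%:E).
    apply: eq_bigr => j _; have [_ g0 gb] := gP j.
    by apply: overlap_mean_sqr_dev => //; rewrite gt_eqF.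
  have dev_ge0 (e : 'I_N.+1 -> R) j :
      0 <= overlap_mean d (g j) * (e j - posterior_closed_form R d N M j) ^+ 2.
    by have [_ g0 _] := gP j; rewrite mulr_ge0 ?sqr_ge0 // ltW.
  split=> [min j|estE est'].
  (* Compared with the closed form, a minimizer has total weighted deviation 0; the weights are
     positive, so each deviation is 0. *)
  + have := min (fun j => posterior_closed_form R d N M j); rewrite !dev lee_fin lerD2l.
    rewrite [leRHS]big1 => [|i _]; last by rewrite subrr expr0n mulr0.
    move=> le0; have /eqP := le_anti (introT andP (conj le0 (sumr_ge0 _ (fun i _ => dev_ge0 est i)))).
    rewrite psumr_eq0 // => /allP /(_ j (mem_index_enum j)) /=.
    have [_ g0 _] := gP j; rewrite mulf_eq0 gt_eqF //= sqrf_eq0 subr_eq0 => /eqP ->.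
    by rewrite postE.
  + rewrite !dev lee_fin lerD2l [leLHS]big1 => [|i _].
      by apply: sumr_ge0 => i _; exact: dev_ge0.
    by rewrite estE postE subrr expr0n mulr0.
- exact: postE.
Qed.
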